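(* There exist a smooth Riemannian manifold $(X,g)$ and an oriented compact smooth submanifold $M$ of $X$ such that $[[M]]$ is homologically mass-minimizing in $(X,g)$, but $M$ cannot be calibrated by any smooth calibration on $(X,g)$.
   Context: Submanifolds are embedded, without boundary. Comass: for an $m$-form $\phi$ on $(X,g)$ and $x\in X$, $\|\phi\|^*_{x,g}=\max\{\phi_x(\overrightarrow V_x):\overrightarrow V_x=e_1\wedge\cdots\wedge e_m \text{ a unit simple } m\text{-vector at } x\}$. A smooth calibration on $(X,g)$ is a smooth $m$-form $\phi$ with $d\phi=0$ and $\sup_X\|\phi\|^*_g=1$. It calibrates an oriented $m$-dimensional submanifold $M$ if $\phi|_M$ equals the volume form of $M$ induced by $g$. For a compactly supported $m$-dimensional de Rham current $T$, its mass is $\mathbf{M}(T)=\sup\{T(\psi):\psi \text{ a smooth } m\text{-form with } \sup_X\|\psi\|^*_{g}\le 1\}$. Two compactly supported currents are homologous if their difference is the boundary of a compactly supported current (boundary being the adjoint of exterior differentiation). $[[M]]$ is the current $\psi\mapsto\int_M\psi$. A current $T$ is homologically mass-minimizing if $\mathbf M(T)\le\mathbf M(T')$ for every compactly supported current $T'$ homologous to $T$. *)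

(* Defs.v *)
From HB Require Import structures.
From mathcomp Require Import all_boot all_order all_algebra.
From mathcomp Require Import all_classical all_reals all_analysis.
Import Order.TTheory GRing.Theory Num.Theory numFieldNormedType.Exports.

Set Implicit Arguments.
Unset Strict Implicit.
Unset Printing Implicit Defensive.

Local Open Scope classical_set_scope.
Local Open Scope ring_scope.

Section SmoothFunctions.
Context {R : realType} {n : nat} {W : normedModType R}.

(* [partials [:: j1; ...; jk] f] is the iterated partial derivative
   d_{j1} ... d_{jk} f. *)
Fixpoint partials (s : seq 'I_n) (f : 'rV[R]_n -> W) : 'rV[R]_n -> W :=
  if s is j :: s' then fun x => 'D_(delta_mx 0 j) (partials s' f) x else f.

(* C^oo on U, meant for open U: only the germs of f at the points of U matter. *)
Definition smooth_on (U : set 'rV[R]_n) (f : 'rV[R]_n -> W) : Prop :=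
  forall (s : seq 'I_n) (x : 'rV[R]_n), U x ->
    {for x, continuous (partials s f)} /\
    (forall j : 'I_n, derivable (partials s f) x (delta_mx 0 j)).

End SmoothFunctions.

(* [cmap] and [cinv] are total functions, but they are only meaningful on [cdom]
   and [ccod], between which they are mutually inverse homeomorphisms. *)
Record chart (R : realType) (n : nat) (T : topologicalType) := Chart {
  cdom : set T;
  ccod : set 'rV[R]_n;
  cmap : T -> 'rV[R]_n;
  cinv : 'rV[R]_n -> T;
  cdom_open : open cdom;
  ccod_open : open ccod;
  cmap_cod : forall p, cdom p -> ccod (cmap p);
  cinv_dom : forall x, ccod x -> cdom (cinv x);
  cmapK : forall p, cdom p -> cinv (cmap p) = p;
  cinvK : forall x, ccod x -> cmap (cinv x) = x;
  cmap_continuous : forall p, cdom p -> {for p, continuous cmap};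
  cinv_continuous : forall x, ccod x -> {for x, continuous cinv} }.

(* Manifolds have no boundary; they need not be connected or compact.  The atlas
   need not be maximal.  [chart_at p] is a preferred chart around p: it
   identifies the tangent space at p with R^n, so that a tangent vector at p is
   always given by its coordinates in [chart_at p]. *)
Record smooth_manifold (R : realType) (n : nat) := SmoothManifold {
  carrier :> topologicalType;
  mfd_hausdorff : hausdorff_space carrier;
  mfd_second_countable : @second_countable carrier;
  atlas_index : choiceType;
  atlas : atlas_index -> chart R n carrier;
  chart_at : carrier -> atlas_index;
  chart_atP : forall p, cdom (atlas (chart_at p)) p;
  atlas_smooth : forall i j,
    smooth_on [set x | ccod (atlas i) x /\ cdom (atlas j) (cinv (atlas i) x)]
      (cmap (atlas j) \o cinv (atlas i)) }.

Arguments atlas {R n} s _.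
Arguments chart_at {R n} s _.

Section Tensors.
Context {R : realType} {n : nat} (X : smooth_manifold R n).

Local Notation phi i := (cmap (atlas X i)).
Local Notation psi i := (cinv (atlas X i)).
Local Notation U i := (ccod (atlas X i)).

(* Coordinates, in the preferred chart of the point q with coordinates x in the
   chart i, of the tangent vector at q with coordinates v in the chart i. *)
Definition tangent_change (i : atlas_index X) (x v : 'rV[R]_n) : 'rV[R]_n :=
  'D_v (phi (chart_at X (psi i x)) \o psi i) x.

Definition smooth_fun (f : X -> R) : Prop :=
  forall i, smooth_on (U i) (f \o psi i).

(* Not necessarily smooth, multilinear or alternating: see [smooth_form]. *)
Definition diff_form (m : nat) : Type := X -> ('I_m -> 'rV[R]_n) -> R.

Definition local_form (m : nat) (w : diff_form m) (i : atlas_index X)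
    (x : 'rV[R]_n) (v : 'I_m -> 'rV[R]_n) : R :=
  w (psi i x) (fun a => tangent_change i x (v a)).

Definition set_arg (m : nat) (v : 'I_m -> 'rV[R]_n) (a : 'I_m) (u : 'rV[R]_n)
  : 'I_m -> 'rV[R]_n := fun b => if b == a then u else v b.

Definition multilinear (m : nat) (w : ('I_m -> 'rV[R]_n) -> R) : Prop :=
  forall (v : 'I_m -> 'rV[R]_n) (a : 'I_m) (c : R) (u u' : 'rV[R]_n),
    w (set_arg v a (c *: u + u')) = c * w (set_arg v a u) + w (set_arg v a u').

Definition alternating_map (m : nat) (w : ('I_m -> 'rV[R]_n) -> R) : Prop :=
  forall (v : 'I_m -> 'rV[R]_n) (a b : 'I_m), a != b -> v a = v b -> w v = 0.

Definition smooth_form (m : nat) (w : diff_form m) : Prop :=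
  (forall p, multilinear (w p) /\ alternating_map (w p)) /\
  (forall i (v : 'I_m -> 'rV[R]_n), smooth_on (U i) (local_form w i ^~ v)).

(* (dw)(v_0, ..., v_m)
     = \sum_k (-1)^k D_{v_k} (w (v_0, ..., v_{k-1}, v_{k+1}, ..., v_m)),
   computed at p in the preferred chart of p, with constant v_0, ..., v_m. *)
Definition ext_deriv (m : nat) (w : diff_form m) : diff_form m.+1 := fun p v =>
  \sum_(k < m.+1) (-1) ^+ k *
    'D_(v k) (local_form w (chart_at X p) ^~ (fun a : 'I_m => v (lift k a)))
      (phi (chart_at X p) p).

Record riemannian_metric := RiemannianMetric {
  metric :> X -> 'rV[R]_n -> 'rV[R]_n -> R;
  rmetric_linear : forall p (c : R) u u' v,
    metric p (c *: u + u') v = c * metric p u v + metric p u' v;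
  rmetric_sym : forall p u v, metric p u v = metric p v u;
  rmetric_pos : forall p u, u != 0 -> 0 < metric p u u;
  rmetric_smooth : forall i (u v : 'rV[R]_n),
    smooth_on (U i) (fun x =>
      metric (psi i x) (tangent_change i x u) (tangent_change i x v)) }.

(* det (g(v_a, v_b)) is the squared norm of the simple vector
   v_0 /\ ... /\ v_{m-1}. *)
Definition gram_det (g : riemannian_metric) (m : nat) (p : X)
    (v : 'I_m -> 'rV[R]_n) : R :=
  \det (\matrix_(a < m, b < m) g p (v a) (v b)).

Definition comass_at (g : riemannian_metric) (m : nat) (w : diff_form m) (p : X)
  : \bar R :=
  ereal_sup [set (w p v)%:E | v in [set v : 'I_m -> 'rV[R]_n | gram_det g p v = 1]].

Definition comass (g : riemannian_metric) (m : nat) (w : diff_form m) : \bar R :=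
  ereal_sup [set comass_at g w p | p in [set: X]].

Definition smooth_calibration (g : riemannian_metric) (m : nat) (w : diff_form m)
  : Prop :=
  [/\ smooth_form w, (forall p v, ext_deriv w p v = 0) & comass g w = 1%E].

(* The compactly supported currents are the functionals on all smooth forms that
   are continuous for the C^oo topology (uniform convergence on compact sets of
   all derivatives in charts), i.e. that are bounded by a multiple of finitely
   many of its seminorms; the support lies in the finite union of the compact
   sets that occur in them.  The values of T at non-smooth forms are junk. *)
Definition current (m : nat) (T : diff_form m -> R) : Prop :=
  (forall (c : R) (w h : diff_form m), smooth_form w -> smooth_form h ->
     T (fun p v => c * w p v + h p v) = c * T w + T h) /\
  (exists (N : nat) (i : 'I_N -> atlas_index X) (K : 'I_N -> set 'rV[R]_n)
     (k : nat) (C : R),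
     (forall l, compact (K l) /\ K l `<=` U (i l)) /\
     (forall (w : diff_form m) (B : R), smooth_form w -> 0 <= B ->
        (forall l (s : seq 'I_n) (e : 'I_m -> 'I_n) x,
           (size s <= k)%N -> K l x ->
           `|partials s
               (local_form w (i l) ^~ (fun a => delta_mx 0 (e a))) x| <= B) ->
        `|T w| <= C * B)).

Definition boundary (m : nat) (S : diff_form m.+1 -> R) : diff_form m -> R :=
  fun w => S (ext_deriv w).

Definition homologous (m : nat) (T T' : diff_form m -> R) : Prop :=
  exists S : diff_form m.+1 -> R, current S /\
    (forall w, smooth_form w -> T w - T' w = boundary S w).

Definition mass (g : riemannian_metric) (m : nat) (T : diff_form m -> R) : \bar R :=
  ereal_sup [set (T w)%:E | w in
    [set w : diff_form m | smooth_form w /\ (comass g w <= 1)%E]].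

Definition homologically_mass_minimizing (g : riemannian_metric) (m : nat)
    (T : diff_form m -> R) : Prop :=
  forall T' : diff_form m -> R, current T' -> homologous T' T ->
    (mass g T <= mass g T')%E.

Definition oriented_atlas : Prop :=
  forall i j (x : 'rV[R]_n), U i x -> cdom (atlas X j) (psi i x) ->
    0 < \det ('J (phi j \o psi i) x).

(* Integral over R^k of a continuous compactly supported function, as an
   iterated integral. *)
Fixpoint rV_integral (k : nat) : ('rV[R]_k -> R) -> R :=
  if k is k'.+1 then fun f =>
    Rintegral lebesgue_measure setT
      (fun t : R => rV_integral (fun y : 'rV[R]_k' => f (row_mx t%:M y)))
  else fun f => f 0.

(* The integral of a top-degree form supported in the domain of the chart i. *)
Definition chart_integral (i : atlas_index X) (w : diff_form n) : R :=
  rV_integral (fun x =>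
    if x \in U i then local_form w i x (fun a => delta_mx 0 a) else 0).

Definition partition_of_unity (s : seq (atlas_index X * (X -> R))) : Prop :=
  (forall q, q \in s ->
     [/\ smooth_fun q.2, (forall p, 0 <= q.2 p)
       & closure [set p | q.2 p != 0] `<=` cdom (atlas X q.1)]) /\
  (forall p, \sum_(q <- s) q.2 p = 1).

(* Meant for compact X with an oriented atlas: a finite partition of unity then
   exists and the value does not depend on the one that is chosen. *)
Definition form_integral (w : diff_form n) : R :=
  \sum_(q <- xget [::] [set s | partition_of_unity s])
    chart_integral q.1 (fun p v => q.2 p * w p v).

End Tensors.

Section Maps.
Context {R : realType} {m n : nat}.
Variables (N : smooth_manifold R m) (X : smooth_manifold R n) (f : N -> X).

Definition smooth_map : Prop :=
  continuous f /\
  (forall i j,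
     smooth_on [set x | ccod (atlas N i) x /\
                        cdom (atlas X j) (f (cinv (atlas N i) x))]
       (cmap (atlas X j) \o f \o cinv (atlas N i))).

Definition differential (p : N) (v : 'rV[R]_m) : 'rV[R]_n :=
  'D_v (cmap (atlas X (chart_at X (f p))) \o f \o
        cinv (atlas N (chart_at N p))) (cmap (atlas N (chart_at N p)) p).

Definition smooth_embedding : Prop :=
  [/\ smooth_map,
      (forall p v, differential p v = 0 -> v = 0),
      injective f
    & forall A : set N, open A -> exists2 B : set X, open B & A = f @^-1` B].

Definition pullback (k : nat) (w : diff_form X k) : diff_form N k :=
  fun p v => w (f p) (fun a => differential p (v a)).

End Maps.

(* An embedded submanifold is given by its inclusion.  The empty set is excluded:
   it is homologically mass-minimizing in every dimension m, and it could not be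
   calibrated in X when m > dim X, there being no calibration at all. *)
Record oriented_compact_submanifold (R : realType) (n : nat)
    (X : smooth_manifold R n) (m : nat) := OrientedCompactSubmanifold {
  sub_mfd :> smooth_manifold R m;
  sub_nonempty : [set: sub_mfd] !=set0;
  sub_compact : compact [set: sub_mfd];
  sub_oriented : oriented_atlas sub_mfd;
  inclusion : sub_mfd -> X;
  inclusion_embedding : smooth_embedding inclusion }.

Arguments inclusion {R n X m} o _.

Section Submanifolds.
Context {R : realType} {n : nat} (X : smooth_manifold R n) {m : nat}.
Variable M : oriented_compact_submanifold X m.

Definition integration_current : diff_form X m -> R :=
  fun w => form_integral (pullback (inclusion M) w).

(* sqrt(det(g_{ab})) dx_1 /\ ... /\ dx_m, where g_{ab} is the induced metric in
   the preferred (positively oriented) chart of p. *)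
Definition volume_form (g : riemannian_metric X) : diff_form M m := fun p v =>
  Num.sqrt (gram_det g (inclusion M p)
              (fun a : 'I_m => differential (inclusion M) p (delta_mx 0 a))) *
  \det (\matrix_(a < m, b < m) v a 0 b).

Definition calibrates (g : riemannian_metric X) (w : diff_form X m) : Prop :=
  forall (p : M) (v : 'I_m -> 'rV[R]_m),
    pullback (inclusion M) w p v = volume_form g p v.

End Submanifolds.

(* Main.v *)
(* The ambient manifold is the torus T^3 with coordinates (x, y, z), and M is the
   y-circle {x = 0, z = 1/2}.  With s(y) = (pi/2) |sin(pi y)|, which has mean 1 and
   a corner at y = 0 although s^2 is smooth, the metric is (dx + dy)^2 + dx^2 + dz^2
   on {z = 1/2} and (1 + s^2)(dx^2 + dy^2) + dz^2 on {z = 0}, with an interpolation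
   in between that keeps the comass of the Lipschitz closed form
   dx + dy + d(chi(z) k(y)), k' = s - 1, at most 1.  This form calibrates M; smooth
   closed forms of comass at most 1, obtained from polynomial approximations
   of s from below, pair with M to any value below the length of M, so M is
   minimizing.

   A smooth calibration w of M has period 1 along y.  On the flat slice {z = 1/2}
   its y-component is at most 1, hence equal to 1, and then so is its
   x-component: both periods of w are 1.  On {z = 0} write w = du.  Since the
   circle {y = 0} has length 1, u - x is constant on it, and
   u_x^2 + u_y^2 <= 1 + s^2 gives |u_y| <= s wherever u_x = 1.  The maximum principle
   then bounds the growth of u - x from y = 0 to y = 1 by that of the primitive of
   s, which is 1, exactly the period of u.  So u_y = s at x = 0, which is not
   differentiable at y = 0. *)
Require Import Defs.
From HB Require Import structures.
From mathcomp Require Import all_boot all_order all_algebra.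
From mathcomp Require Import all_classical all_reals all_analysis.
From mathcomp Require Import ring lra.
Import Order.TTheory GRing.Theory Num.Theory numFieldNormedType.Exports.

Set Implicit Arguments.
Unset Strict Implicit.
Unset Printing Implicit Defensive.

Local Open Scope classical_set_scope.
Local Open Scope ring_scope.

(** * Primitives and one-variable calculus *)

(** The corner is forced away from M: smoothness fails on the slice z = 0, and closedness carries
    the constraint there, because the periods of a closed form are the same on every slice. M by
    itself only fixes the y-period. The shear in (dx + dy)^2 + dx^2 is what fixes the x-period as
    well: d/dy is a unit vector whose metric dual is dx + dy, and by the equality case of
    Cauchy-Schwarz this is the only covector of norm at most 1 with value 1 on d/dy. On z = 0 both
    periods are extremal, one because s vanishes on the circle y = 0, the other because s has mean
    1; the factor pi/2 is there since |sin(pi y)| has mean 2/pi. Nothing is left free, so the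
    potential must follow the primitive of s exactly. For minimality, currents are tested on smooth
    forms only, so the Lipschitz form cannot be paired with a competitor directly. Its smooth
    substitutes have y-period m at most 1, and the mass inequality appears as m tends to 1.
    Approximating s from below serves both the comass bound and m <= 1. *)

Section OneVariable.
Context {R : realType}.
Implicit Types (f F df : R -> R) (a b x : R).

Lemma is_derive_continuous f x l : is_derive x 1 f l -> {for x, continuous f}.
Proof.
by move=> [dfx _]; exact/differentiable_continuous/derivable1_diffP.
Qed.

Lemma is_derive_within_continuous f df a b :
  (forall x, x \in `[a, b]%R -> is_derive x 1 f (df x)) ->
  {within `[a, b], continuous f}.
Proof.
move=> h; apply: derivable_within_continuous => x xab.
by have [] := h x xab.
Qed.

Lemma is_derive_MVT f df a b : a <= b ->
  (forall x, x \in `[a, b]%R -> is_derive x 1 f (df x)) ->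
  exists2 c, c \in `[a, b]%R & f b - f a = df c * (b - a).
Proof.
move=> ab h; have hc := is_derive_within_continuous h.
have hd : forall x, x \in `]a, b[%R -> is_derive x 1 f (df x).
  by move=> x xab; exact/h/subset_itv_oo_cc.
exact: MVT_segment ab hd hc.
Qed.

Lemma is_derive_eq0_cst f a b : (forall x, x \in `[a, b]%R -> is_derive x 1 f 0) ->
  a <= b -> f a = f b.
Proof.
move=> h ab; have [c _] := is_derive_MVT ab h.
by rewrite mul0r => /eqP; rewrite subr_eq0 => /eqP.
Qed.

Lemma is_derive_eq0 f a b : (forall x, is_derive x 1 f 0) -> f a = f b.
Proof.
move=> h; case: (leP a b) => [ab|/ltW ab]; first exact: is_derive_eq0_cst ab.
by apply/esym; exact: is_derive_eq0_cst ab.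
Qed.

Lemma is_derive_ge0_le f df a b : a <= b ->
  (forall x, x \in `[a, b]%R -> is_derive x 1 f (df x)) ->
  (forall x, x \in `[a, b]%R -> 0 <= df x) -> f a <= f b.
Proof.
move=> ab h df0; have [c cab fE] := is_derive_MVT ab h.
by rewrite -subr_ge0 fE mulr_ge0 ?df0// subr_ge0.
Qed.

Lemma antiderivative_right f a : continuous f ->
  exists F, forall x, a < x -> is_derive x 1 F (f x).
Proof.
move=> cf; exists (fun x => \int[lebesgue_measure]_(t in `[a, x]) f t).
move=> x ax; have xx1 : x < x + 1 by rewrite ltrDl.
have fint : lebesgue_measure.-integrable `[a, x + 1] (EFin \o f).
  apply: continuous_compact_integrable; first exact: segment_compact.
  exact: continuous_subspaceT.
have [d e] := continuous_FTC1_closed xx1 fint ax (cf x).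
by apply: (DeriveDef d); rewrite -derive1E.
Qed.

(** An integral from [a] is differentiated only to the right of [a], so the base point [- |x| - 1]
    moves with [x]. Normalising every primitive to vanish at 0 makes the value independent of the
    base point, and near a given [x] the fixed base [- |x| - 2] can be used instead. *)
Lemma antiderivative f : continuous f ->
  exists F, forall x, is_derive x 1 F (f x).
Proof.
move=> cf.
pose G a := sval (cid (antiderivative_right a cf)).
have GE a : forall x, a < x -> is_derive x 1 (G a) (f x).
  by rewrite /G; case: cid.
pose F a x := G a x - G a 0.
have FE a : forall x, a < x -> is_derive x 1 (F a) (f x).
  move=> x ax; rewrite -[f x]subr0; apply: is_deriveB.
  exact: GE.
have Findep a b x : a < 0 -> b < 0 -> a < x -> b < x -> F a x = F b x.
  move=> a0 b0 ax bx; apply/eqP; rewrite -subr_eq0; apply/eqP.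
  have F0 : (F a - F b) 0 = 0.
    by change (G a 0 - G a 0 - (G b 0 - G b 0) = 0); rewrite !subrr.
  change ((F a - F b) x = 0); rewrite -{}F0.
  have h y : a < y -> b < y -> is_derive y 1 (F a - F b) 0.
    by move=> ay bY; rewrite -(subrr (f y)); apply: is_deriveB; exact: FE.
  case: (leP x 0) => [x0|/ltW x0].
    apply: is_derive_eq0_cst => // y; rewrite in_itv/= => /andP[xy _].
    by apply: h; exact: lt_le_trans xy.
  apply/esym; apply: is_derive_eq0_cst => // y; rewrite in_itv/= => /andP[xy _].
  by apply: h; exact: lt_le_trans xy.
exists (fun x => F (- `|x| - 1) x) => x.
have nx (y : R) : - `|y| - 1 < 0 /\ - `|y| - 1 < y.
  split; first by rewrite ltrBlDr add0r (le_lt_trans _ ltr01)// oppr_le0.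
  by rewrite ltrBlDr; apply: (@le_lt_trans _ _ y); [rewrite lerNl -normrN ler_norm|rewrite ltrDl].
have nx2 : - `|x| - 2 < x.
  by have := (nx x).2; lra.
apply: (@near_eq_is_derive _ _ _ (F (- `|x| - 2))).
  near=> y; apply: Findep; [have := normr_ge0 x; lra| exact: (nx y).1| |exact: (nx y).2].
  by near: y; exact: lt_nbhsr.
exact: FE.
Unshelve. all: by end_near. Qed.

(** One-sided because the maximum it is applied to may sit at the right end of [0, 1]: a negative
    derivative would make [f] larger just to the left of [x]. *)
Lemma is_derive_max_left f x l d : 0 < d -> is_derive x 1 f l ->
  (forall y, x - d <= y <= x -> f y <= f x) -> 0 <= l.
Proof.
move=> d0 [df <-] fx; rewrite leNgt; apply/negP => dlt0.
have : (fun h : R => h^-1 *: (f (h *: 1 + x) - f x)) @ 0^' --> 'D_1 f x by exact: df.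
move=> /cvgrPdist_lt /(_ (- 'D_1 f x)); rewrite oppr_gt0 => /(_ dlt0).
move=> /nbhs_ballP[e /= e0 he].
pose h := - Num.min d (e / 2).
have h0 : 0 < Num.min d (e / 2) by rewrite lt_min d0 divr_gt0.
have := he h; rewrite /ball/= sub0r normrN normrN (gtr0_norm h0).
have hN : h != 0 by rewrite oppr_eq0 gt_eqF.
have -> : Num.min d (e / 2) < e.
  by rewrite gt_min; apply/orP; right; rewrite ltr_pdivrMr// ltr_pMr// ltr1n.
move=> /(_ isT hN); rewrite ltr_norml opprK => /andP[+ _].
rewrite -subr_gt0 addrAC subrr add0r oppr_gt0; rewrite [_%:A]mulr1 /GRing.scale/=.
rewrite nmulr_rlt0 ?invr_lt0 ?oppr_lt0// subr_gt0.
apply/negP; rewrite -leNgt; apply: fx.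
rewrite [h + x]addrC lerD2l gerDl oppr_le0 (ltW h0) andbT /h lerN2.
by rewrite ge_min lexx.
Qed.
End OneVariable.

(** * Differentiation of a primitive with respect to a parameter *)

Section Potential.
Context {R : realType}.
Implicit Types (f df : R -> R) (F G H Phi : R -> R -> R) (a b x t : R).

Lemma is_derive_MVT_sym f df a b : (forall x, is_derive x 1 f (df x)) ->
  exists2 c, `|c - a| <= `|b - a| & f b - f a = df c * (b - a).
Proof.
move=> h; case: (leP a b) => [ab|/ltW ab].
  have [c] := is_derive_MVT ab (fun x _ => h x).
  rewrite in_itv/= => /andP[ac cb] fE; exists c => //.
  by rewrite !ger0_norm ?subr_ge0// lerD2r.
have [c] := is_derive_MVT ab (fun x _ => h x).
rewrite in_itv/= => /andP[ac cb] fE; exists c => //.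
  by rewrite !ler0_norm ?subr_le0// !opprB lerD2l lerN2.
by rewrite -opprB fE -mulrN opprB.
Qed.

Lemma is_derive_quotient f x l :
  (forall e, 0 < e -> \forall h \near 0^', `|l - h^-1 * (f (h + x) - f x)| <= e) ->
  is_derive x 1 f l.
Proof.
move=> hf.
have cv : (fun h : R => h^-1 *: (f (h *: 1 + x) - f x)) @ 0^' --> l.
  apply/cvgrPdist_le => e e0; have := hf e e0; apply: filterS => h.
  by rewrite [_%:A]mulr1.
apply: DeriveDef; first by apply/cvg_ex; exists l.
by apply/cvg_lim.
Qed.

(* Differentiation under the integral sign for a primitive [Phi x] of [F x]
   when the derivative of [F] in the parameter is itself exact in [t]. *)
Lemma is_derive_param F G H Phi :
  (forall x t, is_derive x 1 (F ^~ t) (H x t)) ->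
  (forall x t, is_derive t 1 (G x) (H x t)) ->
  continuous (fun p : R * R => H p.1 p.2) ->
  (forall x t, is_derive t 1 (Phi x) (F x t)) ->
  (forall x, Phi x 0 = 0) ->
  forall x t, is_derive x 1 (Phi ^~ t) (G x t - G x 0).
Proof.
move=> dF dG cH dPhi Phi0 x t; apply: is_derive_quotient => e e0.
pose e1 := e / (`|t| + 1).
have t1 : 0 < `|t| + 1 by rewrite ltr_wpDl.
have e10 : 0 < e1 by rewrite divr_gt0.
(* Compactness of the segment makes the continuity of [H] in the parameter uniform in [u]. *)
have unif : \forall y \near x, `[- `|t|, `|t|]%classic `<=` [set u : R | `|H y u - H x u| <= e1].
  have /compact_near_coveringP := @segment_compact R (- `|t|) `|t|.
  move=> /(_ R (nbhs x) (fun y u => `|H y u - H x u| <= e1) _); apply => u _.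
  have /cvgrPdist_le c1 := cH (x, u).
  have e12 : 0 < e1 / 2 by rewrite divr_gt0.
  have := c1 _ e12; move=> /nbhs_ballP[d /= d0 hd].
  exists (ball u d, ball x d) => /=.
    by split; exact: nbhsx_ballx.
  move=> [w y] /= [uw xy].
  have h1 : `|H x u - H y w| <= e1 / 2 by apply: (hd (y, w)).
  have h2 : `|H x u - H x w| <= e1 / 2 by apply: (hd (x, w)); split => //=; exact: ballxx.
  rewrite (le_trans (ler_distD (H x u) _ _))// (splitr e1) lerD//.
  by rewrite distrC.
have [d /= d0 hd] := unif.
near=> h.
have hN0 : h != 0 by near: h; exact: nbhs_dnbhs_neq.
have hd' : `|h| < d by near: h; exact: dnbhs0_lt.
(* [D] is [h] times the error of the difference quotient, as a function of the upper limit. It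
   vanishes at 0, and the mean value theorem, used in [u] and then in [x], writes it as [h * t]
   times a variation of [H]. *)
pose D u := Phi (h + x) u - Phi x u - h * (G x u - G x 0).
have dD (u : R) : is_derive u 1 D (F (h + x) u - F x u - h * (H x u - 0)).
  apply: is_deriveB; apply: is_deriveZ.
have [c ct DE] := is_derive_MVT_sym 0 t dD.
have cT : `[- `|t|, `|t|]%classic c.
  by rewrite /= in_itv/= -ler_norml; rewrite !subr0 in ct.
have [k kh FE] := is_derive_MVT_sym x (h + x) (dF^~ c).
have xk : `|H k c - H x c| <= e1.
  apply: hd cT; rewrite /ball/= distrC; apply: le_lt_trans hd'.
  by rewrite addrK in kh.
have D0 : D 0 = 0 by rewrite /D !Phi0 !subrr mulr0 subrr.
have Dt : D t = h * (H k c - H x c) * t.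
  by move: DE; rewrite D0 FE addrK !subr0 => ->; ring.
have -> : G x t - G x 0 - h^-1 * (Phi (h + x) t - Phi x t) = - ((H k c - H x c) * t).
  have -> : Phi (h + x) t - Phi x t = D t + h * (G x t - G x 0).
    by rewrite /D subrK.
  rewrite Dt; field; exact: hN0.
rewrite normrN normrM; apply: (@le_trans _ _ (e1 * (`|t| + 1))).
  by apply: ler_pM => //; rewrite lerDl.
by rewrite /e1 divfK// gt_eqF.
Unshelve. all: by end_near. Qed.
End Potential.

(** * The corner forced on a potential *)

Section Corner.
Context {R : realType}.
Implicit Types (x y : R).

(* Antiperiodic: the periodic function s with a corner at the integers is |wave|. *)
Definition wave y : R := pi / 2 * sin (pi * y).
Definition wave_prim y : R := (1 - cos (pi * y)) / 2.

Lemma is_derive_sin_lin (a x : R) :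
  is_derive x 1 (fun u : R => sin (a * u)) (a * cos (a * x)).
Proof.
have d : is_derive x 1 ( *%R a : R -> R) a.
  by rewrite -[X in is_derive _ _ _ X]mulr1; exact: is_deriveZ.
by have := is_derive1_comp (is_derive_sin (a * x)) d; rewrite mulrC.
Qed.

Lemma is_derive_cos_lin (a x : R) :
  is_derive x 1 (fun u : R => cos (a * u)) (- a * sin (a * x)).
Proof.
have d : is_derive x 1 ( *%R a : R -> R) a.
  by rewrite -[X in is_derive _ _ _ X]mulr1; exact: is_deriveZ.
by have := is_derive1_comp (is_derive_cos (a * x)) d; rewrite mulrC mulrN mulNr.
Qed.

Lemma is_derive_wave_prim y : is_derive y 1 wave_prim (wave y).
Proof.
have h := is_deriveB (is_derive_cst (1 : R) y 1) (is_derive_cos_lin pi y).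
have := @is_deriveZ _ _ _ _ (2^-1) _ _ _ h.
rewrite (_ : _ *: (0 - _) = wave y); last first.
  by rewrite /wave /GRing.scale/= sub0r mulNr opprK; ring.
by rewrite (_ : _ \*: _ = wave_prim) //; apply/funext => u; rewrite /wave_prim [RHS]mulrC.
Qed.

Lemma is_derive_wave0 : is_derive (0 : R) 1 wave (pi ^+ 2 / 2).
Proof.
have := @is_deriveZ _ _ _ _ (pi / 2) _ _ _ (is_derive_sin_lin pi (0 : R)).
by rewrite mulr0 cos0 mulr1 /GRing.scale/= mulrAC -expr2.
Qed.

Lemma wave0 : wave 0 = 0. Proof. by rewrite /wave mulr0 sin0 mulr0. Qed.

Lemma wave_primD1 y : wave_prim (y + 1) = 1 - wave_prim y.
Proof. by rewrite /wave_prim mulrDr mulr1 cosDpi; field. Qed.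

Lemma wave_prim0 : wave_prim 0 = 0.
Proof. by rewrite /wave_prim mulr0 cos0 subrr mul0r. Qed.

Lemma wave_primN y : wave_prim (- y) = wave_prim y.
Proof. by rewrite /wave_prim mulrN cosN. Qed.

Lemma waveD1 y : wave (y + 1) = - wave y.
Proof. by rewrite /wave mulrDr mulr1 sinDpi mulrN. Qed.

Lemma waveN y : wave (- y) = - wave y.
Proof. by rewrite /wave mulrN sinN mulrN. Qed.

Lemma wave_ge0 y : 0 <= y <= 1 -> 0 <= wave y.
Proof.
move=> /andP[y0 y1]; rewrite /wave mulr_ge0 ?divr_ge0 ?pi_ge0//.
by rewrite sin_ge0_pi// mulr_ge0 ?pi_ge0//= ler_piMr ?pi_ge0.
Qed.

(** The function [f u - u] is nonincreasing and 1-periodic, hence constant. This is the rigidity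
    behind both slices: a slope at most 1 and a period equal to 1 leave no room. *)
Lemma periodic_slope1 (f df : R -> R) :
  (forall x, is_derive x 1 f (df x)) -> (forall x, df x <= 1) ->
  (forall x, f (x + 1) = f x + 1) ->
  forall x, (forall u, x - 1 <= u <= x + 1 -> f u - u = f x - x) /\ df x = 1.
Proof.
move=> hf df1 f1 x; pose g u := f u - u.
have dg (u : R) : is_derive u 1 g (df u - 1) by exact: is_deriveB.
have mono (u v : R) : u <= v -> g v <= g u.
  move=> uv; rewrite -lerN2.
  have dN (w : R) : is_derive w 1 (- g) (- (df w - 1)) by exact: is_deriveN.
  apply: (is_derive_ge0_le uv (fun x _ => dN x)) => w _.
  by rewrite oppr_ge0 subr_le0.
have g1 (u : R) : g (u + 1) = g u by rewrite /g f1; ring.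
have gx u : x - 1 <= u <= x + 1 -> g u = g x.
  move=> /andP[x0 x1]; have := mono _ _ x0; have := mono _ _ x1.
  have := g1 (x - 1); rewrite subrK g1 => <- l1 l2.
  by apply/eqP; rewrite eq_le l1 l2.
split=> //.
have dc : is_derive (x : R) 1 (cst (g x) : R -> R) 0 by exact: is_derive_cst.
have [_ e1] : is_derive (x : R) 1 g 0.
  apply: near_eq_is_derive dc; near=> u; rewrite gx//; apply/andP; split.
    by apply: ltW; near: u; apply: lt_nbhsr; rewrite gtrBl.
  by apply: ltW; near: u; apply: lt_nbhsl; rewrite ltrDl.
by case: (dg x) => _; rewrite e1 => /esym/eqP; rewrite subr_eq0 => /eqP.
Unshelve. all: by end_near. Qed.

(** * Maximum principle for a potential on the slice z = 0 *)

Section PeriodicPotential.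
Variables (h P Q : R -> R -> R).
Hypothesis hP : forall x y, is_derive x 1 (h ^~ y) (P x y).
Hypothesis hQ : forall x y, is_derive y 1 (h x) (Q x y).
Hypothesis h1 : forall x y, h (x + 1) y = h x y + 1.
Hypothesis PQ : forall x y, P x y ^+ 2 + Q x y ^+ 2 <= 1 + wave y ^+ 2.

Lemma slope_x_le1 x : P x 0 <= 1.
Proof.
have := PQ x 0; rewrite wave0 expr0n addr0; nra.
Qed.

Lemma potential_cst_on_axis x : -1 <= x <= 1 -> h x 0 - x = h 0 0.
Proof.
move=> x1; have [+ _] := periodic_slope1 (hP^~ 0) slope_x_le1 (h1^~ 0) 0.
by move=> /(_ x); rewrite sub0r add0r subr0; apply.
Qed.

Lemma slope_x_origin : P 0 0 = 1.
Proof. by have [] := periodic_slope1 (hP^~ 0) slope_x_le1 (h1^~ 0) 0. Qed.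

Lemma slope_y_origin : Q 0 0 = 0.
Proof.
have q0 : Q 0 0 ^+ 2 <= 0 by have := PQ 0 0; rewrite slope_x_origin wave0; lra.
by apply/eqP; rewrite -sqrf_eq0 eq_le q0 sqr_ge0.
Qed.

(** Bounded partial derivatives make [h] Lipschitz, which supplies the joint continuity needed for a
    maximum to exist. Since pi/2 < 2, both squares are at most 5, hence the bound 3. *)
Lemma slopes_bounded x y : `|P x y| <= 3 /\ `|Q x y| <= 3.
Proof.
have w : wave y ^+ 2 <= 4.
  have /andP[p0 p2] := @pihalf_02 R.
  have s1 : sin (pi * y) ^+ 2 <= 1 by rewrite sin2cos2 gerBl sqr_ge0.
  rewrite /wave exprMn -[leRHS]mulr1; apply: ler_pM; rewrite ?sqr_ge0//.
  by nra.
by have := PQ x y => pq; rewrite !ler_norml; split; apply/andP; split; nra.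
Qed.

Lemma potential_continuous : continuous (fun p : R * R => h p.1 p.2 - p.1).
Proof.
move=> [x y]; apply/cvgrPdist_le => e e0.
pose d := e / 10.
have d0 : 0 < d by rewrite divr_gt0.
exists (ball x d, ball y d) => /=; first by split; exact: nbhsx_ballx.
move=> [u v] /= [xu yv].
have [c _ e1] := is_derive_MVT_sym u x (hP^~ y).
have [k _ e2] := is_derive_MVT_sym v y (hQ u).
have -> : h x y - x - (h u v - u) = P c y * (x - u) + Q u k * (y - v) - (x - u).
  by rewrite -e1 -e2; ring.
have [b1 _] := slopes_bounded c y; have [_ b2] := slopes_bounded u k.
move: xu yv; rewrite /ball/= => xu yv.
rewrite (le_trans (ler_normB _ _))//.
rewrite (le_trans (lerD (ler_normD _ _) (lexx _)))// !normrM.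
apply: (@le_trans _ _ (3 * d + 3 * d + d)); last by rewrite /d; lra.
by rewrite !lerD ?ler_pM// ltW.
Qed.

(** The term [e * y] makes the comparison strict: at a maximum with b > 0 the x-derivative gives P =
    1, hence Q <= wave, so the y-derivative of [v] is at most -e, against [is_derive_max_left]. The
    maximum therefore lies on y = 0, where [h x 0 - x] is constant, and [e] tends to 0. *)
Lemma potential_le_wave_prim y : 0 <= y <= 1 -> h 0 y <= h 0 0 + wave_prim y.
Proof.
move=> /andP[y0 y1]; rewrite -lerBlDr; apply/ler_addgt0Pr => e e0.
pose v (p : R * R) := h p.1 p.2 - p.1 - wave_prim p.2 - e * p.2.
have cv : continuous v.
  have c2 : continuous (fun p : R * R => wave_prim p.2 + e * p.2).
    move=> p; apply: (@continuous_comp _ _ _ snd (fun u : R => wave_prim u + e * u)).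
      exact: cvg_snd.
    apply: (@is_derive_continuous _ _ _ (wave p.2 + e *: 1)).
    by apply: is_deriveD; exact: is_derive_wave_prim.
  rewrite (_ : v = fun p => (h p.1 p.2 - p.1) - (wave_prim p.2 + e * p.2)).
    move=> p; apply: cvgB; [exact: potential_continuous|exact: c2].
  by apply/funext => p; rewrite /v opprD addrA.
pose I := `[(0:R), 1]%classic.
have [|||[a b] + vmax] := @compact_EVT_max _ _ v (I `*` I).
- by exists (0, 0); split; rewrite /I/= in_itv/= lexx ler01.
- by apply: compact_setX; exact: segment_compact.
- exact: continuous_subspaceT.
rewrite inE /I/= !in_itv/= => -[/andP[a0 a1] /andP[b0 b1]].
have {}vmax x u : 0 <= x <= 1 -> 0 <= u <= 1 -> v (x, u) <= v (a, b).
  by move=> hx hu; apply: vmax; rewrite inE; split; rewrite /I/= in_itv.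
have vper x u : v (x + 1, u) = v (x, u) by rewrite /v /= h1; ring.
(* Periodicity in x extends the maximum to a larger interval, so that [a] is an interior point even
   when it is 0 or 1. *)
have vmax' x u : -1 <= x <= 2 -> 0 <= u <= 1 -> v (x, u) <= v (a, b).
  move=> /andP[x1 x2] hu; case: (ltP x 0) => [xlt0|x0].
    by rewrite -vper vmax//; lra.
  case: (leP x 1) => [xle1|xgt1]; first by rewrite vmax// x0.
  by rewrite -(subrK 1 x) vper vmax//; lra.
have [b00|bN0] := eqVneq b 0.
  have : v (0, y) <= v (a, b) by rewrite vmax// ?lexx ?ler01 ?y0.
  rewrite b00 /v /= potential_cst_on_axis; last by rewrite a1 (le_trans _ a0)// oppr_le0.
  rewrite subr0 mulr0 wave_prim0 !subr0 => l.
  have : e * y <= e by rewrite ler_piMr// ltW.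
  by move: l; lra.
have bgt0 : 0 < b by rewrite lt0r bN0.
have dx : is_derive a 1 (fun x => v (x, b)) (P a b - 1 - 0 - 0).
  rewrite /v/=; apply: is_deriveB.
have dx0 : P a b = 1.
  have le12 : (-1 : R) <= 2 by lra.
  have dv t : t \in `]-1, 2[%R -> derivable (fun x => v (x, b)) t 1.
    by move=> _; rewrite /v/=; do 3!apply: derivableB => //; case: (hP t b).
  have aI : a \in `]-1, 2[%R by rewrite in_itv/=; lra.
  have [|_] := derive1_at_max le12 dv aI.
    move=> t; rewrite in_itv/= => /andP[t1 t2].
    by apply: vmax'; rewrite ?b0 // !ltW.
  by case: dx => _ ->; rewrite !subr0 => /eqP; rewrite subr_eq0 => /eqP.
have dy : is_derive b 1 (fun u => v (a, u)) (Q a b - 0 - wave b - e *: 1).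
  have dw := is_derive_wave_prim b.
  by rewrite /v/=; apply: is_deriveB; apply: is_deriveB.
have qw : Q a b <= wave b.
  have w0 : 0 <= wave b by rewrite wave_ge0// b0.
  have := PQ a b; rewrite dx0; nra.
suff : 0 <= Q a b - 0 - wave b - e *: 1.
  by rewrite [_ *: _]mulr1; lra.
apply: (is_derive_max_left bgt0 dy) => u /andP[u1 u2].
by apply: vmax; [rewrite a0|apply/andP; split; lra].
Qed.
End PeriodicPotential.

(** Adding [wave] gives a function that vanishes on the left of 0, which forces the derivative -
    pi^2 / 2. Subtracting [wave] and reflecting in 0 treats the right side with the same [zero_left]
    and forces + pi^2 / 2. *)
Lemma corner_not_derivable (q : R -> R) :
  (forall y, 0 <= y < 1 -> q y = wave y) ->
  (forall y, -1 < y <= 0 -> q y = - wave y) -> ~ derivable q 0 1.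
Proof.
move=> qr ql dq; have {dq}dq := derivableP dq.
set l := 'D_1 q 0 in dq.
have zero_left (f : R -> R) (m : R) : is_derive (0 : R) 1 f m ->
    (forall y, -1 < y <= 0 -> f y = 0) -> m = 0.
  move=> df f0; have h2 : 0 < 2^-1 :> R by lra.
  have f00 y : 0 - 2^-1 <= y <= 0 -> f y = f 0.
    by move=> /andP[y1 y2]; rewrite !f0//; lra.
  have dN : is_derive (0 : R) 1 (- f) (- m) by exact: is_deriveN.
  have m1 : 0 <= - m.
    apply: (is_derive_max_left h2 dN) => y hy.
    by change (- f y <= - f 0); rewrite f00.
  have m2 : 0 <= m by apply: (is_derive_max_left h2 df) => y hy; rewrite f00.
  lra.
have dw := @is_derive_wave0.
have d1 : is_derive (0 : R) 1 (q + wave) (l + pi ^+ 2 / 2) := is_deriveD dq dw.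
have e1 := zero_left _ _ d1.
have {}e1 : l + pi ^+ 2 / 2 = 0.
  by apply: e1 => y hy; change (q y + wave y = 0); rewrite ql// addNr.
have d2 : is_derive (- 0 : R) 1 (q - wave) (l - pi ^+ 2 / 2).
  by rewrite oppr0; exact: is_deriveB dq dw.
have e2 := zero_left _ _ (is_derive1_comp d2 (is_deriveNid (0 : R) 1)).
have {}e2 : (l - pi ^+ 2 / 2) * -1 = 0.
  apply: e2 => y hy; change (q (- y) - wave (- y) = 0); rewrite qr ?subrr//.
  by move: hy => /andP[y1 y2]; lra.
have : 0 < (pi : R) ^+ 2 by rewrite exprn_gt0// pi_gt0.
lra.
Qed.

(** The y-period 1 equals [wave_prim 1], so the upper bound from y = 0 and the one read backwards
    from y = 1 meet: [h 0 y] equals [h 0 0 + wave_prim y] on [0, 1]. The period carries this formula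
    to y < 0, and differentiation gives the two branches of the corner. *)
Lemma no_smooth_potential (h P Q : R -> R -> R) :
  (forall x y, is_derive x 1 (h ^~ y) (P x y)) ->
  (forall x y, is_derive y 1 (h x) (Q x y)) ->
  (forall x y, h (x + 1) y = h x y + 1) ->
  (forall x y, h x (y + 1) = h x y + 1) ->
  (forall x y, P x y ^+ 2 + Q x y ^+ 2 <= 1 + wave y ^+ 2) ->
  ~ derivable (Q 0) 0 1.
Proof.
move=> hP hQ h1 h2 PQ.
have up := potential_le_wave_prim hP hQ h1 PQ.
(* The point reflection preserves all hypotheses on the potential and turns the upper bound into a
   lower one. *)
pose h' x y := - h (- x) (1 - y).
have lo y : 0 <= y <= 1 -> h' 0 y <= h' 0 0 + wave_prim y.
  apply: (@potential_le_wave_prim h' (fun x y => P (- x) (1 - y)) (fun x y => Q (- x) (1 - y))).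
  - move=> x u; rewrite -[P _ _]opprK -[- P _ _]mulrN1.
    have := is_deriveN (is_derive1_comp (hP (- x) (1 - u)) (is_deriveNid (x : R) 1)).
    exact.
  - move=> x u; rewrite -[Q _ _]opprK -[- Q _ _]mulrN1.
    have d : is_derive u 1 (fun u : R => 1 - u) (0 - 1) by exact: is_deriveB.
    rewrite sub0r in d.
    have := is_deriveN (@is_derive1_comp R (h (- x)) (fun u => 1 - u) u _ _ (hQ _ _) d).
    exact.
  - move=> x u; rewrite /h'; have := h1 (- (x + 1)) (1 - u).
    by rewrite opprD subrK => ->; ring.
  - move=> x u; have -> : wave u = wave (1 - u) by rewrite addrC waveD1 waveN opprK.
    exact: PQ.
have eqh y : 0 <= y <= 1 -> h 0 y = h 0 0 + wave_prim y.
  move=> y01; apply/eqP; rewrite eq_le up//=.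
  have y01' : 0 <= 1 - y <= 1 by move: y01 => /andP[? ?]; lra.
  have := lo _ y01'; rewrite /h' oppr0 addr0 opprB subrKC.
  have := h2 0 0; rewrite add0r => ->.
  have -> : wave_prim (1 - y) = 1 - wave_prim y by rewrite addrC wave_primD1 wave_primN.
  by lra.
apply: corner_not_derivable => y /andP[y0 y1].
- move: y0; rewrite le_eqVlt => /predU1P[<-|y0].
    by rewrite (slope_y_origin hP h1 PQ) wave0.
  have d1 : is_derive y 1 (fun u : R => h 0 0 + wave_prim u) (0 + wave y).
    by have := is_derive_wave_prim y => dw; apply: is_deriveD.
  have : is_derive y 1 (h 0) (0 + wave y).
    apply: near_eq_is_derive d1; near=> u; rewrite [h 0 u]eqh//; apply/andP; split.
      by apply: ltW; near: u; exact: lt_nbhsr.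
    by apply: ltW; near: u; exact: lt_nbhsl.
  by case: (hQ 0 y) => _ <- [_ ->]; rewrite add0r.
- move: y1; rewrite le_eqVlt => /predU1P[->|y1].
    by rewrite (slope_y_origin hP h1 PQ) wave0 oppr0.
  have d1 : is_derive y 1 (fun u : R => h 0 0 - wave_prim u) (0 - wave y).
    by have := is_derive_wave_prim y => dw; apply: is_deriveB.
  have : is_derive y 1 (h 0) (0 - wave y).
    apply: near_eq_is_derive d1; near=> u.
    have uI : 0 <= u + 1 <= 1.
      have : u < 0 by near: u; exact: lt_nbhsl.
      have : - 1 < u by near: u; exact: lt_nbhsr.
      by lra.
    have := h2 0 u; rewrite eqh// wave_primD1; lra.
  by case: (hQ 0 y) => _ <- [_ ->]; rewrite sub0r.
Unshelve. all: by end_near. Qed.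

End Corner.

(** * Potentials and periods of closed 1-forms on R^3 *)

Section SpacePotential.
Context {R : realType}.
Implicit Types x y z : R.
Variables (P Q S Hxy Hxz Hyz : R -> R -> R -> R).
Hypothesis cP : forall y z, continuous (fun x => P x y z).
Hypothesis cQ : forall x z, continuous (fun y => Q x y z).
Hypothesis cS : forall x y, continuous (fun z => S x y z).
Hypothesis dQx : forall x y z, is_derive x 1 (fun x => Q x y z) (Hxy x y z).
Hypothesis dPy : forall x y z, is_derive y 1 (fun y => P x y z) (Hxy x y z).
Hypothesis dSx : forall x y z, is_derive x 1 (fun x => S x y z) (Hxz x y z).
Hypothesis dPz : forall x y z, is_derive z 1 (fun z => P x y z) (Hxz x y z).
Hypothesis dSy : forall x y z, is_derive y 1 (fun y => S x y z) (Hyz x y z).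
Hypothesis dQz : forall x y z, is_derive z 1 (fun z => Q x y z) (Hyz x y z).
Hypothesis cHxy : forall z, continuous (fun p : R * R => Hxy p.1 p.2 z).
Hypothesis cHxz : forall y, continuous (fun p : R * R => Hxz p.1 y p.2).
Hypothesis cHyz : forall x, continuous (fun p : R * R => Hyz x p.1 p.2).

Lemma antiderivative0 (f : R -> R) : continuous f ->
  exists2 F : R -> R, (forall x, is_derive x 1 F (f x)) & F 0 = 0.
Proof.
move=> /antiderivative[F hF]; exists (fun x => F x - F 0); last exact: subrr.
by move=> x; rewrite -[f x]subr0; exact: is_deriveB.
Qed.

Lemma space_potential : exists h : R -> R -> R -> R,
  [/\ forall x y z, is_derive x 1 (fun x => h x y z) (P x y z),
      forall x y z, is_derive y 1 (fun y => h x y z) (Q x y z)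
    & forall x y z, is_derive z 1 (fun z => h x y z) (S x y z)].
Proof.
have [A hA _] := antiderivative0 (@cP 0 0).
pose B x := s2val (cid2 (antiderivative0 (@cQ x 0))).
have hB x y : is_derive y 1 (B x) (Q x y 0) by rewrite /B; case: cid2.
have B0 x : B x 0 = 0 by rewrite /B; case: cid2.
pose C x y := s2val (cid2 (antiderivative0 (@cS x y))).
have hC x y z : is_derive z 1 (C x y) (S x y z) by rewrite /C; case: cid2.
have C0 x y : C x y 0 = 0 by rewrite /C; case: cid2.
have Bx := is_derive_param (fun x t => dQx x t 0) (fun x t => dPy x t 0) (@cHxy 0) hB B0.
have Cx y := is_derive_param (fun x t => dSx x y t) (fun x t => dPz x y t) (@cHxz y)
  (fun x => hC x y) (fun x => C0 x y).
have Cy x := is_derive_param (fun y t => dSy x y t) (fun y t => dQz x y t) (@cHyz x)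
  (hC x) (C0 x).
exists (fun x y z => A x + B x y + C x y z); split=> x y z.
- have -> : P x y z = P x 0 0 + (P x y 0 - P x 0 0) + (P x y z - P x y 0) by ring.
  exact: (is_deriveD (is_deriveD (hA x) (Bx x y)) (Cx y x z)).
- have -> : Q x y z = 0 + Q x y 0 + (Q x y z - Q x y 0) by ring.
  exact: (is_deriveD (is_deriveD (is_derive_cst (A x) y 1) (hB x y)) (Cy x y z)).
- have -> : S x y z = 0 + S x y z by ring.
  exact: (is_deriveD (is_derive_cst (A x + B x y) z 1) (hC x y z)).
Qed.

Hypothesis P1 : forall x y z, P (x + 1) y z = P x y z /\ P x (y + 1) z = P x y z.
Hypothesis Q1 : forall x y z, Q (x + 1) y z = Q x y z /\ Q x (y + 1) z = Q x y z.
Hypothesis S1 : forall x y z, S (x + 1) y z = S x y z /\ S x (y + 1) z = S x y z.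
Variable z1 : R.
Hypothesis PQ0 : forall x y, P x y 0 ^+ 2 + Q x y 0 ^+ 2 <= 1 + wave y ^+ 2.
Hypothesis PQ1 : forall x y a b,
  (a * P x y z1 + b * Q x y z1) ^+ 2 <= (a + b) ^+ 2 + a ^+ 2.
Hypothesis Q01 : forall y, Q 0 y z1 = 1.

Lemma grad0_cst (g : R -> R -> R -> R) :
  (forall x y z, is_derive x 1 (fun x => g x y z) 0) ->
  (forall x y z, is_derive y 1 (fun y => g x y z) 0) ->
  (forall x y z, is_derive z 1 (fun z => g x y z) 0) ->
  forall x y z, g x y z = g 0 0 z1.
Proof.
move=> gx gy gz x y z.
rewrite (is_derive_eq0 x 0 (fun x => gx x y z)).
rewrite (is_derive_eq0 y 0 (fun y => gy 0 y z)).
exact: (is_derive_eq0 z z1 (fun z => gz 0 0 z)).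
Qed.

Lemma is_derive_comp_shift (f : R -> R) (x l : R) :
  is_derive (x + 1) 1 f l -> is_derive x 1 (fun x => f (x + 1)) l.
Proof.
move=> df; rewrite -[l]mulr1.
have d : is_derive x 1 (fun u : R => u + 1) (1 + 0) by exact: is_deriveD.
rewrite addr0 in d.
exact: (@is_derive1_comp _ f (fun u => u + 1) x _ _ df d).
Qed.

(** The increments of [h] over unit translations in x and y have zero gradient, since the
    coefficients are periodic. They are thus constants, which can be computed on the slice z1 and
    used on the slice z = 0. *)
Lemma no_smooth_closed_form : ~ derivable (fun y => Q 0 y 0) 0 1.
Proof.
have [h [hx hy hz]] := space_potential.
have per1 := @grad0_cst (fun x y z => h (x + 1) y z - h x y z).
have per2 := @grad0_cst (fun x y z => h x (y + 1) z - h x y z).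
have {}per1 x y z : h (x + 1) y z - h x y z = h (0 + 1) 0 z1 - h 0 0 z1.
  apply: per1 => {}x {}y {}z.
  - rewrite -(subrr (P x y z)); apply: is_deriveB (hx x y z).
    by rewrite -(P1 x y z).1; apply: is_derive_comp_shift; exact: hx.
  - rewrite -(subrr (Q x y z)); apply: is_deriveB (hy x y z).
    by rewrite -(Q1 x y z).1; exact: hy.
  - rewrite -(subrr (S x y z)); apply: is_deriveB (hz x y z).
    by rewrite -(S1 x y z).1; exact: hz.
have {}per2 x y z : h x (y + 1) z - h x y z = h 0 (0 + 1) z1 - h 0 0 z1.
  apply: per2 => {}x {}y {}z.
  - rewrite -(subrr (P x y z)); apply: is_deriveB (hx x y z).
    by rewrite -(P1 x y z).2; exact: hx.
  - rewrite -(subrr (Q x y z)); apply: is_deriveB (hy x y z).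
    by rewrite -(Q1 x y z).2; apply: is_derive_comp_shift; exact: hy.
  - rewrite -(subrr (S x y z)); apply: is_deriveB (hz x y z).
    by rewrite -(S1 x y z).2; exact: hz.
have c2 : h 0 (0 + 1) z1 - h 0 0 z1 = 1.
  have d (y : R) : is_derive y 1 (fun y => h 0 y z1 - y) 0.
    by have := is_deriveB (hy 0 y z1) (is_derive_id y 1); rewrite Q01 subrr.
  by have := is_derive_eq0 (0 + 1) 0 d; rewrite subr0 add0r => <-; ring.
have Q1_le x y : Q x y z1 <= 1.
  by have := PQ1 x y 0 1; rewrite mul0r mul1r add0r add0r => ?; nra.
(* [Q01] concerns M only; the common y-period spreads the value 1 to every y-line of the slice. *)
have Qz1 x y : Q x y z1 = 1.
  have hx1 u : h x (u + 1) z1 = h x u z1 + 1 by have := per2 x u z1; rewrite c2; lra.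
  have K := periodic_slope1 (fun y : R => hy x y z1) (Q1_le x) hx1 y.
  exact: K.2.
have Pz1 x y : P x y z1 = 1.
  (* The test vector is (t, 1). Taking its first entry proportional to P - 1 turns the first-order
     term of the inequality [PQ1] into a square, and what remains is t^2 times a positive factor. *)
  set t := (P x y z1 - 1) / 2.
  have pE : P x y z1 = 1 + 2 * t by rewrite /t; field.
  have le0 : t ^+ 2 * ((2 * t + 1) ^+ 2 + 2) <= 0.
    by have := PQ1 x y t 1; rewrite Qz1 pE; nra.
  have : t ^+ 2 <= 0.
    by rewrite pmulr_lle0 // in le0; rewrite ltr_wpDl ?sqr_ge0.
  rewrite le_eqVlt ltNge sqr_ge0 orbF sqrf_eq0 => /eqP t0.
  by rewrite pE t0 mulr0 addr0.
have c1 : h (0 + 1) 0 z1 - h 0 0 z1 = 1.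
  have d (x : R) : is_derive x 1 (fun x => h x 0 z1 - x) 0.
    by have := is_deriveB (hx x 0 z1) (is_derive_id x 1); rewrite Pz1 subrr.
  by have := is_derive_eq0 (0 + 1) 0 d; rewrite subr0 add0r => <-; ring.
apply: (@no_smooth_potential _ (fun x y => h x y 0) (fun x y => P x y 0) (fun x y => Q x y 0)) => //.
- by move=> x y; have := per1 x y 0; rewrite c1; lra.
- by move=> x y; have := per2 x y 0; rewrite c2; lra.
Qed.
End SpacePotential.

(** * Flat tori *)

Section Torus.
Context {R : realType} {n : nat}.
Implicit Types (x y c : 'rV[R]_n).

Definition lattice_eq x y := forall i, x 0 i - y 0 i \is a Num.int.

(* The representative of the class of [x] modulo Z^n in the box with lower
   corner [c]. *)
Definition lift_at c x : 'rV[R]_n :=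
  \row_i (x 0 i - (Num.floor (x 0 i - c 0 i))%:~R).

Definition box c : set 'rV[R]_n := [set x | forall i, c 0 i < x 0 i < c 0 i + 1].

Lemma lattice_eq_sym x y : lattice_eq x y -> lattice_eq y x.
Proof. by move=> h i; rewrite -opprB rpredN h. Qed.

Lemma lattice_eq_trans x y z : lattice_eq x y -> lattice_eq y z -> lattice_eq x z.
Proof. by move=> h k i; rewrite -(subrKA (y 0 i)) rpredD. Qed.

Lemma lattice_eq_add x y z : lattice_eq x y -> lattice_eq (x + z) (y + z).
Proof. by move=> h i; rewrite !mxE opprD addrACA subrr addr0 h. Qed.

Lemma lift_at_lattice c x : lattice_eq (lift_at c x) x.
Proof. by move=> i; rewrite mxE addrAC subrr add0r rpredN intr_int. Qed.

Lemma lift_at_eq c x y : lattice_eq x y -> lift_at c x = lift_at c y.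
Proof.
move=> h; apply/rowP => i; rewrite !mxE.
have /intrP[k hk] := h i; have -> : x 0 i = y 0 i + k%:~R by rewrite -hk subrKC.
rewrite [y 0 i + _ - c 0 i]addrAC floorDrz ?intr_int// intrKfloor rmorphD/=.
by rewrite opprD addrACA subrr addr0.
Qed.

Lemma lift_at_ge c x i : c 0 i <= lift_at c x 0 i < c 0 i + 1.
Proof.
have /andP[] := floor_itv (x 0 i - c 0 i); rewrite mxE rmorphD/= => h1 h2.
by apply/andP; split; lra.
Qed.

Lemma lift_at_id c x : (forall i, c 0 i <= x 0 i < c 0 i + 1) -> lift_at c x = x.
Proof.
move=> h; apply/rowP => i; rewrite mxE (@floor_def _ _ 0) ?subr0//.
by have /andP[h1 h2] := h i; rewrite add0r; apply/andP; split; lra.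
Qed.

Lemma lift_at_box c x : box c x -> lift_at c x = x.
Proof. by move=> h; apply: lift_at_id => i; have /andP[/ltW -> ->] := h i. Qed.

Lemma box_nbhs c x : box c x -> nbhs x (box c).
Proof.
move=> xc; have := @filter_forall _ _ (fun i (y : 'rV[R]_n) => c 0 i < y 0 i < c 0 i + 1) (nbhs x) _.
apply => i; have /andP[h1 h2] := xc i.
have cc : (y : 'rV[R]_n) 0 i @[y --> x] --> x 0 i by exact: coord_continuous.
have n1 : nbhs x [set y : 'rV[R]_n | c 0 i < y 0 i].
  by move: (cc [set t | c 0 i < t]); apply; exact: lt_nbhsr.
have n2 : nbhs x [set y : 'rV[R]_n | y 0 i < c 0 i + 1].
  by move: (cc [set t | t < c 0 i + 1]); apply; exact: lt_nbhsl.
by apply: filterS (filterI n1 n2) => y [/= -> ->].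
Qed.

Lemma translate_near x v (A : set 'rV[R]_n) :
  nbhs (x + v) A -> \forall y \near x, A (y + v).
Proof.
have H := @cvgD R 'rV[R]_n 'rV[R]_n (nbhs x) _ id (cst v) x v.
by move=> hA; apply: H hA; [exact: cvg_id|exact: cvg_cst].
Qed.

Lemma open_box c : open (box c).
Proof. by rewrite openE => x; exact: box_nbhs. Qed.

End Torus.

(** Points are canonical representatives in the half-open unit cube, so that equality of points is
    equality of vectors. The topology given to them below is the quotient topology along
    [torus_proj], not that of the cube. *)
Record torus (R : realType) (n : nat) :=
  Torus { torus_rep : 'rV[R]_n; torus_repP : lift_at 0 torus_rep == torus_rep }.

HB.instance Definition _ (R : realType) (n : nat) := [isSub for @torus_rep R n].
HB.instance Definition _ (R : realType) (n : nat) := [Choice of torus R n by <:].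

(** * Quotient topology and charts of the torus *)

Section TorusTopology.
Context {R : realType} {n : nat}.
Implicit Types (x y c : 'rV[R]_n) (p q : torus R n).

Fact torus_proj_proof x : lift_at 0 (lift_at 0 x) == lift_at 0 x.
Proof. by rewrite (lift_at_eq _ (lift_at_lattice 0 x)). Qed.

Definition torus_proj x : torus R n := Torus (torus_proj_proof x).

Lemma torus_repK p : torus_proj (torus_rep p) = p.
Proof. by apply: val_inj => /=; apply/eqP; exact: torus_repP. Qed.

Lemma torus_proj_eq x y : lattice_eq x y -> torus_proj x = torus_proj y.
Proof. by move=> h; apply: val_inj; exact: lift_at_eq. Qed.

Lemma torus_proj_inj x y : torus_proj x = torus_proj y -> lattice_eq x y.
Proof.
move=> /(congr1 (@torus_rep R n)) /= h; apply: lattice_eq_trans (lift_at_lattice 0 y).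
by rewrite -h; exact/lattice_eq_sym/lift_at_lattice.
Qed.

Lemma lift_at_proj c x : lift_at c (torus_rep (torus_proj x)) = lift_at c x.
Proof. exact/lift_at_eq/lift_at_lattice. Qed.

Lemma torus_proj_lift_at c x : torus_proj (lift_at c x) = torus_proj x.
Proof. exact/torus_proj_eq/lift_at_lattice. Qed.

Definition torus_open : set_system (torus R n) := [set U | open (torus_proj @^-1` U)].

Fact torus_openT : torus_open setT.
Proof. by rewrite /torus_open/= preimage_setT; exact: openT. Qed.

Fact torus_openI : setI_closed torus_open.
Proof. by move=> A B oA oB; rewrite /torus_open/= preimage_setI; exact: openI. Qed.

Fact torus_open_bigU (I : Type) (f : I -> set (torus R n)) :
  (forall i, torus_open (f i)) -> torus_open (\bigcup_i f i).
Proof. by move=> h; rewrite /torus_open/= preimage_bigcup; apply: bigcup_open => i _; exact: h. Qed.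

HB.instance Definition _ := isOpenTopological.Build (torus R n)
  torus_openT torus_openI torus_open_bigU.

Lemma torus_openE (U : set (torus R n)) : open U = open (torus_proj @^-1` U).
Proof. by []. Qed.

Lemma torus_proj_continuous : continuous torus_proj.
Proof. by apply/continuousP => A. Qed.

Lemma torus_continuous (Z : topologicalType) (f : torus R n -> Z) :
  continuous (f \o torus_proj) -> continuous f.
Proof. by move=> /continuousP h; apply/continuousP => A /h. Qed.

Lemma torus_proj_open (A : set 'rV[R]_n) : open A -> open (torus_proj @` A).
Proof.
move=> oA; rewrite torus_openE openE => y [x Ax /torus_proj_inj xy].
have near_xy : \forall z \near y, A (z + (x - y)).
  by apply: translate_near; rewrite subrKC; exact: open_nbhs_nbhs.
apply: filterS near_xy => z Az; exists (z + (x - y)) => //.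
by apply: torus_proj_eq => i; rewrite !mxE addrAC subrr add0r; exact: xy.
Qed.

Lemma torus_proj_nbhs x (A : set 'rV[R]_n) : nbhs x A -> nbhs (torus_proj x) (torus_proj @` A).
Proof.
rewrite nbhsE => -[B [oB Bx] BA]; rewrite nbhsE; exists (torus_proj @` B).
  by split; [exact: torus_proj_open|exists x].
exact: image_subset.
Qed.

Definition torus_chart_map c p := lift_at c (torus_rep p).
Definition torus_chart_dom c : set (torus R n) := torus_chart_map c @^-1` box c.

Lemma torus_chart_domE c : torus_chart_dom c = torus_proj @` box c.
Proof.
apply/seteqP; split=> [p hp|_ [x hx <-]].
  by exists (torus_chart_map c p) => //; rewrite torus_proj_lift_at torus_repK.
by rewrite /torus_chart_dom /torus_chart_map/= lift_at_proj lift_at_box.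
Qed.

Fact torus_chart_dom_open c : open (torus_chart_dom c).
Proof. by rewrite torus_chart_domE; apply/torus_proj_open/open_box. Qed.

Fact torus_chart_map_box c p : torus_chart_dom c p -> box c (torus_chart_map c p).
Proof. by []. Qed.

Fact torus_proj_chart_dom c x : box c x -> torus_chart_dom c (torus_proj x).
Proof. by rewrite torus_chart_domE; exists x. Qed.

Fact torus_chart_mapK c p : torus_chart_dom c p -> torus_proj (torus_chart_map c p) = p.
Proof. by move=> _; rewrite torus_proj_lift_at torus_repK. Qed.

Fact torus_projK c x : box c x -> torus_chart_map c (torus_proj x) = x.
Proof. by move=> h; rewrite /torus_chart_map lift_at_proj lift_at_box. Qed.

Fact torus_chart_map_continuous c p :
  torus_chart_dom c p -> {for p, continuous (torus_chart_map c)}.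
Proof.
move=> hp V hV.
have hB : nbhs (torus_chart_map c p) (V `&` box c).
  by apply: filterI => //; exact: box_nbhs.
have := torus_proj_nbhs hB; rewrite (torus_chart_mapK hp).
by apply: filterS => _ [x [Vx xc] <-] /=; rewrite torus_projK.
Qed.

Definition torus_chart c : chart R n (torus R n) :=
  Chart (@torus_chart_dom_open c) (@open_box _ _ c) (@torus_chart_map_box c)
    (@torus_proj_chart_dom c) (@torus_chart_mapK c) (@torus_projK c)
    (@torus_chart_map_continuous c) (fun x _ => @torus_proj_continuous x).

(** Away from the faces of the box the floors are locally constant, so a chart composed with the
    projection is locally a translation. All smoothness and orientation facts about the torus come
    from this. *)
Lemma lift_at_near c x : box c (lift_at c x) ->
  \forall y \near x, lift_at c y = y + (lift_at c x - x).
Proof.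
move=> hx.
have near_box : \forall y \near x, box c (y + (lift_at c x - x)).
  by apply: translate_near; rewrite subrKC; exact: box_nbhs.
apply: filterS near_box => y hy; rewrite -[RHS](lift_at_box hy).
apply: lift_at_eq => i; rewrite !mxE.
rewrite (_ : _ - _ = (Num.floor (x 0 i - c 0 i))%:~R) ?intr_int//; ring.
Qed.

Lemma torus_second_countable : @second_countable (torus R n).
Proof.
pose b (qk : 'rV[rat]_n * nat) : set (torus R n) :=
  torus_proj @` ball (map_mx ratr qk.1 : 'rV[R]_n) (qk.2.+1%:R^-1).
exists (range b).
  exact: card_le_trans (card_image_le _ _) (countableP _).
split=> [_ [qk _ <-]|p V].
  by apply: torus_proj_open; exact: ball_open.
rewrite -(torus_repK p); set x := torus_rep p => /torus_proj_continuous/nbhs_ballP[e /= e0 he].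
have [k ke] : exists k : nat, k.+1%:R^-1 < e / 2.
  have e20 : 0 < e / 2 by rewrite divr_gt0.
  by have [k] := ltr_add_invr e20; rewrite add0r => ?; exists k.
have k0 : 0 < k.+1%:R^-1 :> R by rewrite invr_gt0.
pose q : 'rV[rat]_n := \row_i sval (cid (rat_in_itvoo
  (ltr_pwDr k0 (lexx (x 0 i))))).
have qx : ball (map_mx ratr q : 'rV[R]_n) k.+1%:R^-1 x.
  split=> // i j; rewrite ord1 !mxE; case: cid => r /=.
  rewrite in_itv/= /ball/= => /andP[r1 r2].
  by rewrite ger0_norm ?subr_ge0 ?(ltW r1)// ltrBlDl.
exists (b (q, k)); first by split; [exists (q, k)|exists x].
move=> _ [y qy <-]; apply: he => /=.
rewrite (splitr e); apply: ball_triangle (le_ball (ltW ke) qy).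
exact/ball_sym/(le_ball (ltW ke) qx).
Qed.

End TorusTopology.

(** * Iterated partial derivatives *)

Section Smoothness.
Context {R : realType} {n : nat}.

Section General.
Context {W : normedModType R}.
Implicit Types (f g : 'rV[R]_n -> W) (U : set 'rV[R]_n) (s : seq 'I_n) (x : 'rV[R]_n).

Lemma partials_near f g s x : (\forall y \near x, f y = g y) ->
  \forall y \near x, partials s f y = partials s g y.
Proof.
move=> fg; elim: s => [//|j s IH] /=.
by apply: filterS (nbhs_interior IH) => y; exact: near_eq_derive.
Qed.

Lemma near_eq_continuous f g x : (\forall y \near x, f y = g y) ->
  {for x, continuous f} -> {for x, continuous g}.
Proof.
move=> fg cf; have e : f x = g x := nbhs_singleton fg.
have cf' : g @ x --> f x by exact: (cvg_trans (near_eq_cvg fg) cf).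
by rewrite e in cf'.
Qed.

Lemma smooth_on_near U f :
  (forall x, U x -> exists g, smooth_on setT g /\ \forall y \near x, g y = f y) ->
  smooth_on U f.
Proof.
move=> h s x Ux; have [g [sg gf]] := h x Ux; have gfs := partials_near s gf.
have [cg dg] := sg s x I; split; first exact: near_eq_continuous gfs cg.
by move=> j; apply: near_eq_derivable (dg j).
Qed.

(** A coinduction principle for smoothness: a class of continuous, derivable functions that is
    stable under partial derivatives contains all the iterated ones, so none of them has to be
    computed. *)
Lemma smooth_class (C : ('rV[R]_n -> W) -> Prop) U :
  (forall f, C f -> continuous f) ->
  (forall f, C f -> forall x j, derivable f x (delta_mx 0 j)) ->
  (forall f, C f -> forall j, C (fun x => 'D_(delta_mx 0 j) f x)) ->
  forall f, C f -> smooth_on U f.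
Proof.
move=> Cc Cd CD f Cf s x _.
have Cs : C (partials s f) by elim: s => [//|j s IH]; exact: CD.
by split=> [|j]; [exact: Cc|exact: Cd].
Qed.
End General.

Lemma mx_continuous {T : topologicalType} {m k : nat} (M : T -> 'M[R]_(m, k)) (x : T) :
  (forall i j, {for x, continuous (fun y => M y i j)}) -> {for x, continuous M}.
Proof.
move=> h; apply/cvgrPdist_le => /= e e0.
have h2 (ij : 'I_m * 'I_k) : \forall y \near x, `|M x ij.1 ij.2 - M y ij.1 ij.2| <= e.
  by have /cvgrPdist_le := h ij.1 ij.2; apply.
have H := @filter_forall _ _ (fun ij y => `|M x ij.1 ij.2 - M y ij.1 ij.2| <= e) (nbhs x) _ h2.
near=> y; have hy : forall ij : 'I_m * 'I_k, `|M x ij.1 ij.2 - M y ij.1 ij.2| <= e by near: y; exact: H.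
rewrite /Num.Def.normr/= mx_normrE (bigmax_le _ (ltW e0))//= => ij _.
by rewrite !mxE.
Unshelve. all: by end_near. Qed.

Lemma affine_continuous {m : nat} (A : 'M[R]_(n, m)) (b : 'rV[R]_m) :
  continuous (fun y : 'rV[R]_n => y *m A + b).
Proof.
move=> x; apply: mx_continuous => i j.
apply: differentiable_continuous.
rewrite (_ : (fun y => _) =
  (\sum_k (fun y : 'rV[R]_n => y i k * A k j)) + cst (b i j)); last first.
  apply/funext => y; rewrite !mxE; congr (_ + _).
  by rewrite fct_sumE.
apply: differentiableD => //; apply: differentiable_sum => k.
by apply: differentiableM => //; exact: differentiable_coord.
Qed.

Lemma is_derive_affine {m : nat} (A : 'M[R]_(n, m)) (b : 'rV[R]_m) (x v : 'rV[R]_n) :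
  is_derive x v (fun y : 'rV[R]_n => y *m A + b) (v *m A).
Proof.
have cv : (fun h : R => h^-1 *: ((h *: v + x) *m A + b - (x *m A + b))) @ 0^'
    --> v *m A.
  apply: cvg_near_cst; near=> h.
  have h0 : h != 0 by near: h; exact: nbhs_dnbhs_neq.
  rewrite mulmxDl opprD addrACA subrr addr0 addrK -scalemxAl scalerA mulVf//.
  by rewrite scale1r.
apply: DeriveDef; first by apply/cvg_ex; exists (v *m A).
exact/cvg_lim.
Unshelve. all: by end_near. Qed.

Lemma smooth_affine {m : nat} (A : 'M[R]_(n, m)) (b : 'rV[R]_m) U :
  smooth_on U (fun y : 'rV[R]_n => y *m A + b).
Proof.
pose C (f : 'rV[R]_n -> 'rV[R]_m) := exists A b, f = fun y => y *m A + b.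
apply: (@smooth_class _ C); last by exists A, b.
- by move=> _ [A' [b' ->]]; exact: affine_continuous.
- by move=> _ [A' [b' ->]] x j; have [] := is_derive_affine A' b' x (delta_mx 0 j).
- move=> _ [A' [b' ->]] j; exists 0, (delta_mx 0 j *m A'); apply/funext => x.
  by rewrite mulmx0 add0r; have [_ ->] := is_derive_affine A' b' x (delta_mx 0 j).
Qed.

Lemma smooth_translate (v : 'rV[R]_n) U : smooth_on U (fun y => y + v).
Proof.
have := @smooth_affine _ 1%:M v U; congr smooth_on; apply/funext => y.
by rewrite mulmx1.
Qed.

Lemma is_derive_translate (v x u : 'rV[R]_n) : is_derive x u (fun y => y + v) u.
Proof.
have := is_derive_affine 1%:M v x u; rewrite mulmx1.
by rewrite (_ : (fun y => _) = (fun y => y + v))//; apply/funext => y; rewrite mulmx1.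
Qed.
End Smoothness.

(** * The torus as a manifold *)

Section TorusManifold.
Context {R : realType}.

Definition periodic1 {T : Type} (f : R -> T) := forall a, f (a + 1) = f a.

Lemma periodic1_int {T : Type} (f : R -> T) a k : periodic1 f ->
  k \is a Num.int -> f (a + k) = f a.
Proof.
move=> pf /intrP[z ->].
have pn b (m : nat) : f (b + m%:R) = f b.
  by elim: m b => [|m IH] b; rewrite ?addr0// -natr1 addrA pf.
case: z => m; first exact: pn.
by rewrite NegzE rmorphN/= -(pn _ m.+1) subrK.
Qed.

Lemma circle_eq (a b : R) : 0 <= a < 1 -> 0 <= b < 1 ->
  cos (2 * pi * a) = cos (2 * pi * b) -> sin (2 * pi * a) = sin (2 * pi * b) -> a = b.
Proof.
move=> /andP[a0 a1] /andP[b0 b1] ec es.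
have : cos (2 * pi * a - 2 * pi * b) = 1.
  by rewrite cosB ec es -!expr2 cos2Dsin2.
rewrite (_ : _ - _ = (pi * (a - b)) *+ 2); last by rewrite -mulr_natl; ring.
rewrite cos_mulr2n cos2sin2 => s2.
have /eqP : sin (pi * (a - b)) ^+ 2 = 0 by move: s2; rewrite -mulr_natl; lra.
rewrite sqrf_eq0 => /eqP s0; have pp := @pi_gt0 R.
have aux (u : R) : 0 < u -> u < 1 -> 0 < sin (pi * u).
  by move=> u0 u1; apply: sin_gt0_pi; apply/andP; split; nra.
case: (ltgtP a b) => // ab; exfalso.
  have : 0 < sin (pi * (b - a)) by apply: aux; lra.
  by rewrite -opprB mulrN sinN s0 oppr0 ltxx.
have : 0 < sin (pi * (a - b)) by apply: aux; lra.
by rewrite s0 ltxx.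
Qed.

Context {n : nat}.
Implicit Types (p q : torus R n) (x c : 'rV[R]_n).

Lemma torus_coord_continuous (f : R -> R) (i : 'I_n) : continuous f -> periodic1 f ->
  continuous (fun p : torus R n => f (torus_rep p 0 i)).
Proof.
move=> cf pf; apply: torus_continuous.
rewrite (_ : _ \o _ = (fun x : 'rV[R]_n => f (x 0 i))).
  move=> x; apply: (@continuous_comp _ _ _ (fun x : 'rV[R]_n => x 0 i) f).
    exact: coord_continuous.
  exact: cf.
apply/funext => x /=; have := lift_at_lattice 0 x i.
by move=> h; rewrite -(periodic1_int (x 0 i) pf h) subrKC.
Qed.

(** Continuous 1-periodic functions of a coordinate descend to the torus, and points that cannot be
    separated have the same values under them. The cosine and sine of 2 pi times the coordinate then
    determine it in [0, 1). *)
Lemma torus_hausdorff : hausdorff_space (torus R n).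
Proof.
move=> p q pq; apply: val_inj => /=; apply/rowP => i.
have sep (f : R -> R) : continuous f -> periodic1 f -> f (torus_rep p 0 i) = f (torus_rep q 0 i).
  move=> cf pf; have cF := @torus_coord_continuous f i cf pf.
  apply: Rhausdorff => A B hA hB.
  have [r [Ar Br]] := pq _ _ (cF p A hA) (cF q B hB).
  by exists (f (torus_rep r 0 i)).
have dom (r : torus R n) : 0 <= torus_rep r 0 i < 1.
  rewrite -(eqP (torus_repP r)); have := lift_at_ge 0 (torus_rep r) i.
  by rewrite mxE add0r.
have lin : continuous (fun a : R => 2 * pi * a).
  by move=> a; apply: cvgM; [exact: cvg_cst|exact: cvg_id].
apply: circle_eq => //.
- apply: (sep (fun a => cos (2 * pi * a))).
    by move=> a; apply: continuous_comp; [exact: lin|exact: continuous_cos].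
  by move=> a; rewrite mulrDr mulr1 mulr_natl cosD2pi.
- apply: (sep (fun a => sin (2 * pi * a))).
    by move=> a; apply: continuous_comp; [exact: lin|exact: continuous_sin].
  by move=> a; rewrite mulrDr mulr1 mulr_natl sinD2pi.
Qed.

(** This corner puts [p] at the centre of the box of its preferred chart. *)
Definition torus_base p : 'rV[R]_n := torus_rep p - const_mx (1 / 2).

Fact torus_baseP p : cdom (torus_chart (torus_base p)) p.
Proof.
have hb : box (torus_base p) (torus_rep p).
  by move=> i; rewrite !mxE; apply/andP; split; lra.
by rewrite /= /torus_chart_dom /torus_chart_map/= lift_at_box.
Qed.

Lemma torus_transition_near c' x : box c' (lift_at c' x) ->
  \forall y \near x, y + (lift_at c' x - x) = (torus_chart_map c' \o @torus_proj R n) y.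
Proof.
move=> /lift_at_near; apply: filterS => y <-.
by rewrite /torus_chart_map /= lift_at_proj.
Qed.

Fact torus_smooth c c' :
  smooth_on [set x | ccod (torus_chart c) x /\ cdom (torus_chart c') (cinv (torus_chart c) x)]
    (cmap (torus_chart c') \o cinv (torus_chart c)).
Proof.
apply: smooth_on_near => x /= [_]; rewrite /torus_chart_dom/= /torus_chart_map lift_at_proj => hx.
exists (fun y => y + (lift_at c' x - x)); split; first exact: smooth_translate.
exact: torus_transition_near.
Qed.

Definition torus_manifold : smooth_manifold R n :=
  SmoothManifold torus_hausdorff torus_second_countable torus_baseP torus_smooth.
End TorusManifold.

Arguments torus_manifold R n : clear implicits.

Section TorusTensors.
Context {R : realType} {n : nat}.
Local Notation T := (torus_manifold R n).
Implicit Types (x c v : 'rV[R]_n).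

Lemma torus_transition_derive c' x v : box c' (lift_at c' x) ->
  is_derive x v (torus_chart_map c' \o @torus_proj R n) v.
Proof.
move=> hx; have := is_derive_translate (lift_at c' x - x) x v.
by apply: near_eq_is_derive; exact: torus_transition_near.
Qed.

Lemma torus_base_box (p : T) : box (torus_base p) (lift_at (torus_base p) (torus_rep p)).
Proof. exact: (torus_baseP p). Qed.

Lemma torus_base_box_proj x :
  box (torus_base (torus_proj x)) (lift_at (torus_base (torus_proj x)) x).
Proof. by have := torus_base_box (torus_proj x); rewrite lift_at_proj. Qed.

(** Transitions are translations, so tangent coordinates do not depend on the chart. Forms and
    metrics on the torus can therefore be handled as periodic functions on R^n. *)
Lemma tangent_change_torus c x v : tangent_change (X := T) c x v = v.
Proof.
rewrite /tangent_change.
by have [_] := torus_transition_derive v (torus_base_box_proj x).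
Qed.

Lemma local_form_torus m (w : diff_form T m) c x (v : 'I_m -> 'rV[R]_n) :
  local_form w c x v = w (torus_proj x) v.
Proof.
rewrite /local_form /=; congr (w _ _); apply/funext => a.
exact: tangent_change_torus.
Qed.

Lemma near_translate_jacobian (f : 'rV[R]_n -> 'rV[R]_n) x v :
  (\forall y \near x, y + v = f y) -> 'J f x = 1%:M.
Proof.
move=> fE; have fx : f x = x + v by have := nbhs_singleton fE.
have dfid : 'd f x = idfun :> ('rV[R]_n -> 'rV[R]_n).
  apply: diff_unique; first by move=> y; exact: cvg_id.
  apply/eqaddoP => e e0.
  have near0 : \forall y \near (0 : 'rV[R]_n), (y + x) + v = f (y + x).
    by apply: translate_near (fun y => y + v = f y) _; rewrite add0r.
  apply: filterS near0 => y hy.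
  rewrite (_ : _ y = 0); first by rewrite normr0 mulr_ge0// ltW.
  rewrite /= -[LHS]/(f (y + x) - (f x + y)) -hy fx.
  by apply/eqP; rewrite subr_eq0 -addrA addrC.
apply/matrixP => i j; rewrite /jacobian /lin1_mx mxE dfid /=.
by rewrite !mxE eqxx/= eq_sym.
Qed.

Lemma torus_oriented : oriented_atlas T.
Proof.
move=> c c' x xc /=; rewrite /torus_chart_dom/= /torus_chart_map lift_at_proj => hx.
by rewrite (near_translate_jacobian (torus_transition_near hx)) det1 ltr01.
Qed.

Definition lattice_periodic (f : 'rV[R]_n -> R) :=
  forall x y, lattice_eq x y -> f x = f y.

Lemma lattice_periodic_rep f x : lattice_periodic f ->
  f (torus_rep (torus_proj x)) = f x.
Proof. by move=> pf; apply: pf => /=; exact: lift_at_lattice. Qed.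

End TorusTensors.

(** * A class of smooth functions stable under derivation *)

Section Tame.
Context {R : realType}.

(** A syntactic class, large enough for the metric and the calibrating forms and closed under
    derivation. [Smooth1Prim] admits functions known only through their derivative, such as the
    periodic primitive [k] of the calibrating forms. *)
Inductive smooth1 : (R -> R) -> Prop :=
| Smooth1Cst c : smooth1 (fun _ => c)
| Smooth1Cos a : smooth1 (fun y => cos (a * y))
| Smooth1Sin a : smooth1 (fun y => sin (a * y))
| Smooth1Add f g : smooth1 f -> smooth1 g -> smooth1 (fun y => f y + g y)
| Smooth1Mul f g : smooth1 f -> smooth1 g -> smooth1 (fun y => f y * g y)
| Smooth1Prim (f g : R -> R) : (forall y : R, is_derive y 1 f (g y)) -> smooth1 g -> smooth1 f.

Lemma smooth1_derive f : smooth1 f ->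
  exists2 g, smooth1 g & forall y : R, is_derive y 1 f (g y).
Proof.
elim=> {f} [c|a|a|f g f1 [f' f'1 df] g1 [g' g'1 dg]|f g f1 [f' f'1 df] g1 [g' g'1 dg]|].
- by exists (fun=> 0); [exact: Smooth1Cst|move=> y; exact: is_derive_cst].
- exists (fun y => - a * sin (a * y)); last by move=> y; exact: is_derive_cos_lin.
  by apply: Smooth1Mul; [exact: Smooth1Cst|exact: Smooth1Sin].
- exists (fun y => a * cos (a * y)); last by move=> y; exact: is_derive_sin_lin.
  by apply: Smooth1Mul; [exact: Smooth1Cst|exact: Smooth1Cos].
- exists (fun y => f' y + g' y); first exact: Smooth1Add.
  by move=> y; exact: is_deriveD.
- exists (fun y => f y * g' y + g y * f' y).
    by apply: Smooth1Add; exact: Smooth1Mul.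
  by move=> y; exact: is_deriveM.
- by move=> f g dfg g1 _; exists g.
Qed.

Context {n : nat}.

Inductive tame : ('rV[R]_n -> R) -> Prop :=
| TameCst c : tame (fun _ => c)
| TameCoord i f : smooth1 f -> tame (fun x => f (x 0 i))
| TameAdd f g : tame f -> tame g -> tame (fun x => f x + g x)
| TameMul f g : tame f -> tame g -> tame (fun x => f x * g x).

Lemma is_derive_coord (f f' : R -> R) i (x v : 'rV[R]_n) :
  is_derive (x 0 i) 1 f (f' (x 0 i)) ->
  is_derive x v (fun x => f (x 0 i)) (v 0 i * f' (x 0 i)).
Proof.
move=> df; pose g (h : R) := f (h * v 0 i + x 0 i).
have dl : is_derive (0 : R) 1 (fun h : R => h * v 0 i + x 0 i) (v 0 i).
  have := is_deriveD (is_deriveM (is_derive_id (0 : R) 1) (is_derive_cst (v 0 i) (0 : R) 1))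
    (is_derive_cst (x 0 i) (0 : R) 1).
  by rewrite scaler0 add0r addr0 [_%:A]mulr1.
have dg : is_derive (0 : R) 1 g (v 0 i * f' (x 0 i)).
  rewrite mulrC.
  apply: (@is_derive1_comp _ f (fun h : R => h * v 0 i + x 0 i) 0 _ _ _ dl).
  by rewrite mul0r add0r.
have Fg : (fun h : R => f ((h *: v + x) 0 i)) = g.
  by apply/funext => h; rewrite !mxE.
have [dg1 dg2] := dg.
apply: DeriveDef; first by apply/derivable1P; rewrite Fg.
rewrite -dg2; apply: (congr1 (fun k : R -> R => lim (k @ 0^'))); apply/funext => h.
by rewrite /= /g [_%:A]mulr1 addr0 mul0r add0r !mxE.
Qed.

Lemma tame_differentiable f : tame f -> forall x, differentiable f x.
Proof.
elim=> {f} [c|i f f1|f g _ df _ dg|f g _ df _ dg] x.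
- exact: (@differentiable_cst R _ R).
- have [f' _ df] := smooth1_derive f1.
  apply: (@differentiable_comp _ _ _ _ (fun x : 'rV[R]_n => x 0 i : R) f).
    exact: differentiable_coord.
  by apply/derivable1_diffP; case: (df (x 0 i)).
- exact: (@differentiableD _ _ _ f g).
- exact: (@differentiableM _ _ f g).
Qed.

Lemma tame_derive f j : tame f ->
  exists2 g, tame g & forall x : 'rV[R]_n, is_derive x (delta_mx 0 j) f (g x).
Proof.
elim=> {f} [c|i f f1|f g _ [f' f'1 df] _ [g' g'1 dg]|f g tf [f' f'1 df] tg [g' g'1 dg]].
- by exists (fun=> 0); [exact: TameCst|move=> x; exact: is_derive_cst].
- have [f' f'1 df] := smooth1_derive f1.
  exists (fun x => (delta_mx 0 j : 'rV[R]_n) 0 i * f' (x 0 i)).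
    exact: TameMul (TameCst _) (TameCoord i f'1).
  by move=> x; apply: (@is_derive_coord f f'); exact: df.
- exists (fun x => f' x + g' x); first exact: TameAdd.
  by move=> x; exact: is_deriveD.
- exists (fun x => f x * g' x + g x * f' x).
    by apply: TameAdd; exact: TameMul.
  by move=> x; exact: is_deriveM.
Qed.

Lemma tame_smooth f U : tame f -> smooth_on U f.
Proof.
apply: smooth_class => {}f tf.
- by move=> x; exact/differentiable_continuous/tame_differentiable.
- by move=> x j; have [g _ /(_ x)[]] := tame_derive j tf.
- move=> j; have [g tg dg] := tame_derive j tf.
  rewrite (_ : (fun x => _) = g)//; apply/funext => x.
  by have [_ ->] := dg x.
Qed.

Lemma derive_sum_partials (f : 'rV[R]_n -> R) x v : differentiable f x ->
  'D_v f x = \sum_j v 0 j * 'D_(delta_mx 0 j) f x.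
Proof.
move=> df; rewrite deriveE// {1}(row_sum_delta v) linear_sum.
by apply: eq_bigr => j _; rewrite linearZ/= deriveE.
Qed.

End Tame.

(** * One-forms and their exterior derivative *)

Section OneFormsManifold.
Context {R : realType} {n : nat} (X : smooth_manifold R n).
Implicit Types (u : 'rV[R]_n) (w : diff_form X 1).

Lemma one_formE w p (v : 'I_1 -> 'rV[R]_n) : multilinear (w p) ->
  w p v = \sum_j v ord0 0 j * w p (fun=> delta_mx 0 j).
Proof.
move=> lw; pose L u := w p (fun=> u).
have set1 (u' : 'I_1 -> 'rV[R]_n) u : set_arg u' ord0 u = fun=> u.
  by apply/funext => b; rewrite /set_arg (ord1 b) eqxx.
have LD c u u' : L (c *: u + u') = c * L u + L u'.
  by have := lw v ord0 c u u'; rewrite !set1.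
have L0 : L 0 = 0 by have := LD 1 0 0; rewrite scaler0 addr0 mul1r => /eqP; rewrite -subr_eq subrr eq_sym => /eqP.
have -> : w p v = L (v ord0).
  by rewrite /L; congr (w p _); apply/funext => b; rewrite (ord1 b).
rewrite {1}(row_sum_delta (v ord0)); elim: (index_enum _) => [|j s IH].
  by rewrite !big_nil.
by rewrite !big_cons LD IH.
Qed.

End OneFormsManifold.

Section OneForms.
Context {R : realType} {n : nat}.
Local Notation T := (torus_manifold R n).
Implicit Types (x y u v : 'rV[R]_n) (w : diff_form T 1).

Definition coef w j x : R := w (torus_proj x) (fun=> delta_mx 0 j).

Lemma coef_periodic w j : lattice_periodic (coef w j).
Proof. by move=> x y /torus_proj_eq xy; rewrite /coef xy. Qed.

Lemma coef_smooth w j : smooth_form w -> smooth_on setT (coef w j).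
Proof.
move=> [_ sw] s x _; pose c := x - const_mx (1 / 2).
have xc : box c x by move=> i; rewrite !mxE; apply/andP; split; lra.
have := sw c (fun=> delta_mx 0 j).
rewrite (_ : (local_form w c)^~ _ = coef w j); last first.
  by apply/funext => y; rewrite local_form_torus.
by move=> /(_ s x xc).
Qed.

Lemma derive_lattice_periodic (f : 'rV[R]_n -> R) x y v : lattice_periodic f ->
  lattice_eq x y -> 'D_v f x = 'D_v f y.
Proof.
move=> pf xy; apply: (congr1 (fun k : R -> R => lim (k @ 0^'))); apply/funext => h /=.
congr (_ *: (_ - _)); last exact: pf.
by apply: pf; rewrite [_ + x]addrC [_ + y]addrC; exact: lattice_eq_add.
Qed.

Lemma ext_deriv_torus w x (v : 'I_2 -> 'rV[R]_n) :
  (forall p, multilinear (w p)) -> (forall y a j, derivable (coef w j) y (v a)) ->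
  ext_deriv w (torus_proj x) v =
    \sum_j v (lift ord0 ord0) 0 j * 'D_(v ord0) (coef w j) x -
    \sum_j v ord0 0 j * 'D_(v (lift ord0 ord0)) (coef w j) x.
Proof.
move=> lw dw; rewrite /ext_deriv /=.
(* The preferred chart sees the point at a lattice translate of [x]; the coefficients being
   periodic, their derivatives agree there. *)
set x' := torus_chart_map _ _.
have xx' : lattice_eq x' x.
  by rewrite /x' /torus_chart_map lift_at_proj; exact: lift_at_lattice.
have term (u : 'I_1 -> 'rV[R]_n) a c : 'D_(v a) (local_form w c ^~ u) x' =
    \sum_j u ord0 0 j * 'D_(v a) (coef w j) x.
  have -> : local_form w c ^~ u = \sum_j (u ord0 0 j \*: coef w j).
    apply/funext => y; rewrite local_form_torus one_formE// fct_sumE.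
    by apply: eq_bigr.
  rewrite derive_sum => [|j]; last exact: derivableZ.
  apply: eq_bigr => j _; rewrite deriveZ//.
  by rewrite (derive_lattice_periodic _ (coef_periodic w j) xx').
rewrite big_ord_recl big_ord1.
have e1 : (-1 : R) ^+ (lift ord0 ord0 : 'I_2) = -1 by [].
rewrite [X in X * _ + _](_ : _ = 1)// mul1r e1 mulN1r.
have l0 : lift (lift ord0 ord0 : 'I_2) ord0 = ord0 by exact: val_inj.
have t0 := term (fun a => v (lift ord0 a)) ord0 (chart_at T (torus_proj x)).
have t1 := term (fun a => v (lift (lift ord0 ord0) a)) (lift ord0 ord0)
  (chart_at T (torus_proj x)).
rewrite l0 in t1.
congr (_ - _).
exact: t0.
exact: t1.
Qed.
End OneForms.

Section FormOf.
Context {R : realType} {n : nat}.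
Local Notation T := (torus_manifold R n).
Variable a : 'I_n -> 'rV[R]_n -> R.
Hypothesis ta : forall j, tame (a j).
Hypothesis pa : forall j, lattice_periodic (a j).

Definition form_of : diff_form T 1 := fun p v => \sum_j v ord0 0 j * a j (torus_rep p).

Lemma form_of_proj x v : form_of (torus_proj x) v = \sum_j v ord0 0 j * a j x.
Proof. by apply: eq_bigr => j _; rewrite lattice_periodic_rep. Qed.

Lemma form_of_multilinear p : multilinear (form_of p).
Proof.
move=> v b c u u'; rewrite /form_of (ord1 b) /set_arg /= mulr_sumr -big_split/=.
by apply: eq_bigr => j _; rewrite !mxE mulrDl mulrA.
Qed.

Lemma form_of_coef j : coef form_of j = a j.
Proof.
apply/funext => x; rewrite /coef form_of_proj (bigD1 j)//= mxE !eqxx mul1r.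
by rewrite big1 ?addr0// => k kj; rewrite mxE (negbTE kj) andbF mul0r.
Qed.

Lemma form_of_smooth : smooth_form form_of.
Proof.
split=> [p|c v].
  split; first exact: form_of_multilinear.
  by move=> v' b b'; rewrite (ord1 b) (ord1 b') eqxx.
rewrite (_ : (local_form form_of c)^~ v = fun x => \sum_j v ord0 0 j * a j x).
  apply: tame_smooth.
  elim: (index_enum _) => [|j s IH].
    rewrite (_ : (fun x => _) = fun _ => 0); first exact: TameCst.
    by apply/funext => x; rewrite big_nil.
  rewrite (_ : (fun x => _) = fun x => v ord0 0 j * a j x + \sum_(k <- s) v ord0 0 k * a k x).
    by apply: TameAdd IH; apply: TameMul (ta j); exact: TameCst.
  by apply/funext => x; rewrite big_cons.
by apply/funext => x; rewrite local_form_torus form_of_proj.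
Qed.

Lemma form_of_closed : (forall i j x, 'D_(delta_mx 0 i) (a j) x = 'D_(delta_mx 0 j) (a i) x) ->
  forall p v, ext_deriv form_of p v = 0.
Proof.
move=> sym p v; rewrite -[p](@torus_repK R n); set x := torus_rep p.
rewrite (@ext_deriv_torus R n form_of x v); last 2 first.
- exact: form_of_multilinear.
- by move=> y b j; rewrite form_of_coef; exact/diff_derivable/tame_differentiable.
have dsum u j : 'D_u (coef form_of j) x = \sum_k u 0 k * 'D_(delta_mx 0 k) (a j) x.
  by rewrite form_of_coef derive_sum_partials//; exact: tame_differentiable.
have e b c : \sum_j v b 0 j * 'D_(v c) (coef form_of j) x =
    \sum_j \sum_k v b 0 j * (v c 0 k * 'D_(delta_mx 0 k) (a j) x).
  by apply: eq_bigr => j _; rewrite dsum mulr_sumr.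
apply/eqP; rewrite subr_eq0; apply/eqP.
apply: etrans (e _ _) _; apply: etrans (esym (e _ _)).
rewrite [LHS]exchange_big; apply: eq_bigr => j _; apply: eq_bigr => k _.
by rewrite (sym j k) mulrCA.
Qed.
End FormOf.

(** * Comass of one-forms *)

Section Comass.
Context {R : realType} {n : nat} (X : smooth_manifold R n) (g : riemannian_metric X).
Implicit Types (w : diff_form X 1) (p : X).

Lemma gram_det1 p (v : 'I_1 -> 'rV[R]_n) : gram_det g p v = g p (v ord0) (v ord0).
Proof. by rewrite /gram_det det_mx11 mxE. Qed.

Lemma metric0 p : g p 0 0 = 0.
Proof.
have := rmetric_linear g p 1 0 0 0; rewrite scaler0 addr0 mul1r => /eqP.
by rewrite -subr_eq subrr eq_sym => /eqP.
Qed.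

Lemma metricZ p c u : g p (c *: u) (c *: u) = c ^+ 2 * g p u u.
Proof.
have lin v c' u' : g p (c' *: u') v = c' * g p u' v.
  have := rmetric_linear g p c' u' 0 v; rewrite addr0 => ->.
  have := rmetric_linear g p 1 0 0 v; rewrite scaler0 addr0 mul1r => /eqP.
  by rewrite -subr_eq subrr eq_sym => /eqP ->; rewrite addr0.
by rewrite lin rmetric_sym lin mulrA expr2.
Qed.

(** By homogeneity the bound on unit vectors extends to all vectors after division by [r], the norm
    of [v]. The supremum bounds [w] only from above, so both signs of the unit vector are tested to
    control the square. *)
Lemma comass_le1P w : (forall p, multilinear (w p)) ->
  (comass g w <= 1)%E <-> forall p v, w p v ^+ 2 <= g p (v ord0) (v ord0).
Proof.
move=> lw; split=> [cw p v|h]; last first.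
  apply: ge_ereal_sup => _ [p _ <-]; apply: ge_ereal_sup => _ [v /= g1 <-].
  rewrite gram_det1 in g1; rewrite lee_fin.
  by have := h p v; rewrite g1 -(expr1n _ 2) => ?; nra.
have [v0|vN0] := eqVneq (v ord0) 0.
  rewrite one_formE// v0 metric0 big1 ?expr0n//.
  by move=> j _; rewrite mxE mul0r.
have gp := rmetric_pos g p vN0; set G := g p _ _ in gp *.
have unit u : g p u u = 1 -> w p (fun=> u) <= 1.
  move=> gu; rewrite -lee_fin; apply: le_trans cw.
  apply: (@le_trans _ _ (comass_at g w p)).
    by apply: ereal_sup_ubound; exists (fun=> u) => //=; rewrite gram_det1.
  by apply: ereal_sup_ubound; exists p.
have scale c : w p (fun=> c *: v ord0) = c * w p v.
  rewrite !one_formE// mulr_sumr; apply: eq_bigr => j _.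
  by rewrite mxE mulrA.
pose r := Num.sqrt G; have r0 : 0 < r by rewrite sqrtr_gt0.
have r2 : r ^+ 2 = G by rewrite sqr_sqrtr// ltW.
have u1 (e : R) : e ^+ 2 = 1 -> e * w p v <= r.
  move=> e1; have := unit ((e / r) *: v ord0).
  rewrite metricZ -/G -r2 expr_div_n e1 mul1r mulVf ?sqrf_eq0 ?gt_eqF// => /(_ erefl).
  by rewrite scale mulrAC ler_pdivrMr// mul1r.
have := u1 1 (expr1n _ _); have := u1 (-1) (sqrr_sign _ 1).
by rewrite mulN1r mul1r -r2; nra.
Qed.
End Comass.

(** * The metric on T^3 *)

Notation k0 := (@Ordinal 3 0 isT).
Notation k1 := (@Ordinal 3 1 isT).
Notation k2 := (@Ordinal 3 2 isT).

Section Vec3.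
Context {R : realType}.
Implicit Types (x u v : 'rV[R]_3).

Definition vec3 (a b c : R) : 'rV[R]_3 := \row_i [:: a; b; c]`_i.

Lemma vec3E a b c :
  (vec3 a b c 0 k0 = a) * (vec3 a b c 0 k1 = b) * (vec3 a b c 0 k2 = c).
Proof. by rewrite !mxE. Qed.

Lemma ord3P (P : 'I_3 -> Prop) : P k0 -> P k1 -> P k2 -> forall i, P i.
Proof.
move=> p0 p1 p2 [[|[|[|//]]] i3].
- by rewrite (_ : Ordinal _ = k0)//; exact: val_inj.
- by rewrite (_ : Ordinal _ = k1)//; exact: val_inj.
- by rewrite (_ : Ordinal _ = k2)//; exact: val_inj.
Qed.

Lemma sum_ord3 (V : nmodType) (F : 'I_3 -> V) : \sum_j F j = F k0 + F k1 + F k2.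
Proof.
rewrite !big_ord_recl big_ord0 addr0 addrA.
by congr (_ + _ + _); congr F; exact: val_inj.
Qed.

Lemma rV3_eq u v : u 0 k0 = v 0 k0 -> u 0 k1 = v 0 k1 -> u 0 k2 = v 0 k2 -> u = v.
Proof. by move=> h0 h1 h2; apply/rowP; exact: ord3P. Qed.

(** The weight is 1 at z = 0 and 0 at z = 1/2, and its derivative vanishes at both, so that the
    factor with [dchi] in the metric is 1 on the two slices that matter. *)
Definition chi (z : R) : R := (1 + cos (2 * pi * z)) / 2.
Definition dchi (z : R) : R := - (pi * sin (2 * pi * z)).

(* The factor 1 + chi'(z)^2 pays for the component chi'(z) k(y) dz of the
   calibrating forms, where |k| <= 1. *)
Definition metric3 x u v : R :=
  (1 + dchi (x 0 k2) ^+ 2) *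
  ((1 - chi (x 0 k2)) * ((u 0 k0 + u 0 k1) * (v 0 k0 + v 0 k1) + u 0 k0 * v 0 k0)
   + chi (x 0 k2) * (1 + wave (x 0 k1) ^+ 2) * (u 0 k0 * v 0 k0 + u 0 k1 * v 0 k1)
   + u 0 k2 * v 0 k2).

Lemma chi_ge0 z : 0 <= chi z.
Proof. by rewrite /chi divr_ge0//; have := cos_geN1 (2 * pi * z); lra. Qed.

Lemma chi_le1 z : chi z <= 1.
Proof. by rewrite /chi ler_pdivrMr//; have := cos_le1 (2 * pi * z); lra. Qed.

Lemma periodic1_chi : periodic1 chi.
Proof. by move=> a; rewrite /chi mulrDr mulr1 mulr_natl cosD2pi. Qed.

Lemma periodic1_dchi : periodic1 dchi.
Proof. by move=> a; rewrite /dchi mulrDr mulr1 mulr_natl sinD2pi. Qed.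

Lemma periodic1_wave2 : periodic1 (fun y : R => wave y ^+ 2).
Proof. by move=> a; rewrite waveD1 sqrrN. Qed.

Lemma periodic1_lattice (f : R -> R) (i : 'I_3) x y : periodic1 f -> lattice_eq x y ->
  f (x 0 i) = f (y 0 i).
Proof. by move=> pf xy; rewrite -(periodic1_int (y 0 i) pf (xy i)) subrKC. Qed.

Lemma metric3_periodic u v : lattice_periodic (fun x => metric3 x u v).
Proof.
move=> x y xy; rewrite /metric3.
rewrite (periodic1_lattice k2 periodic1_chi xy) (periodic1_lattice k2 periodic1_dchi xy).
by rewrite (periodic1_lattice k1 periodic1_wave2 xy).
Qed.

Lemma metric3_pos x u : u != 0 -> 0 < metric3 x u u.
Proof.
move=> uN0; rewrite /metric3 mulr_gt0//.
  by rewrite ltr_wpDr// sqr_ge0.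
set c := chi _; set s := wave _ ^+ 2.
have c0 : 0 <= c by exact: chi_ge0.
have c1 : c <= 1 by exact: chi_le1.
have s0 : 0 <= s by exact: sqr_ge0.
move: c s c0 c1 s0 => c s c0 c1 s0.
have : ~ (u 0 k0 = 0 /\ u 0 k1 = 0 /\ u 0 k2 = 0).
  by move=> [e0 [e1 e2]]; move/eqP: uN0; apply; apply: rV3_eq; rewrite mxE.
move: (u 0 k0) (u 0 k1) (u 0 k2) => a b d abd.
pose A := (a + b) ^+ 2 + a ^+ 2; pose B := a ^+ 2 + b ^+ 2.
rewrite (_ : _ + _ = (1 - c) * A + c * (1 + s) * B + d ^+ 2); last by rewrite /A /B; ring.
have A0 : 0 <= A by rewrite addr_ge0 ?sqr_ge0.
have B0 : 0 <= B by rewrite addr_ge0 ?sqr_ge0.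
have d0 : 0 <= d ^+ 2 by exact: sqr_ge0.
have t1 : 0 <= (1 - c) * A by rewrite mulr_ge0// subr_ge0.
have t2 : 0 <= c * (1 + s) * B by rewrite !mulr_ge0// addr_ge0.
rewrite lt0r !addr_ge0// andbT; apply/negP => /eqP e; apply: abd.
have dz : d ^+ 2 = 0 by lra.
have ab : a ^+ 2 = 0 /\ b ^+ 2 = 0.
  (* [A] and [B] are both positive definite in (a, b), and at least one of them has weight bounded
     away from 0. *)
  have [c2|c2] := leP c (1 / 2).
    have /eqP : (1 - c) * A = 0 by lra.
    rewrite mulf_eq0 subr_eq0 => /orP[/eqP h|/eqP]; first lra.
    rewrite /A => Az; have h1 := sqr_ge0 (a + b); have h2 := sqr_ge0 a.
    have az : a ^+ 2 = 0 by lra.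
    have abz : (a + b) ^+ 2 = 0 by lra.
    move/eqP: az; rewrite sqrf_eq0 => /eqP a0; rewrite a0 in abz *.
    by rewrite add0r in abz; rewrite expr0n.
  have /eqP : c * (1 + s) * B = 0 by lra.
  rewrite !mulf_eq0 => /orP[/orP[/eqP h|/eqP h]|/eqP]; [by lra|by lra|].
  by rewrite /B; have := sqr_ge0 a; have := sqr_ge0 b; lra.
move/eqP: dz; rewrite sqrf_eq0 => /eqP ->.
by case: ab => /eqP + /eqP; rewrite !sqrf_eq0 => /eqP -> /eqP ->.
Qed.

Lemma smooth1_chi : smooth1 chi.
Proof.
exact: Smooth1Mul (Smooth1Add (Smooth1Cst 1) (Smooth1Cos _)) (Smooth1Cst _).
Qed.

Lemma is_derive_chi (z : R) : is_derive z 1 chi (dchi z).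
Proof.
have := is_deriveM (is_deriveD (is_derive_cst (1 : R) z 1) (is_derive_cos_lin (2 * pi) z))
   (is_derive_cst (2^-1 : R) z 1).
rewrite scaler0 !add0r (_ : _ *: _ = dchi z)//.
by rewrite /dchi /GRing.scale/=; field.
Qed.

Lemma smooth1_dchi : smooth1 dchi.
Proof.
rewrite (_ : dchi = fun z => - pi * sin (2 * pi * z)).
  exact: Smooth1Mul (Smooth1Cst _) (Smooth1Sin _).
by apply/funext => z; rewrite /dchi mulNr.
Qed.

Lemma smooth1_wave : smooth1 (@wave R).
Proof. exact: Smooth1Mul (Smooth1Cst _) (Smooth1Sin _). Qed.

Lemma smooth1_sqr (f : R -> R) : smooth1 f -> smooth1 (fun y => f y ^+ 2).
Proof.
by move=> sf; rewrite (_ : (fun y => _) = fun y => f y * f y); [exact: Smooth1Mul|exact/funext].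
Qed.

Lemma metric3_tame u v : tame (fun x => metric3 x u v).
Proof.
have tc : tame (fun x : 'rV[R]_3 => chi (x 0 k2)) := TameCoord k2 smooth1_chi.
rewrite /metric3; apply: TameMul.
  by apply: TameAdd; [exact: TameCst|exact (TameCoord k2 (smooth1_sqr smooth1_dchi))].
apply: TameAdd; last exact: TameCst.
apply: TameAdd; apply: TameMul; try exact: TameCst.
  rewrite (_ : (fun x => _) = fun x : 'rV[R]_3 => 1 + (-1) * chi (x 0 k2)).
    by apply: TameAdd; [exact: TameCst|apply: TameMul => //; exact: TameCst].
  by apply/funext => x; rewrite mulN1r.
apply: TameMul => //; apply: TameAdd; first exact: TameCst.
exact (TameCoord k1 (smooth1_sqr smooth1_wave)).
Qed.

Definition T3 := torus_manifold R 3.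

Definition T3_metric : riemannian_metric T3.
Proof.
refine (@RiemannianMetric R 3 T3 (fun p => metric3 (torus_rep p)) _ _ _ _).
- by move=> p c u u' v; rewrite /metric3 !mxE; ring.
- by move=> p u v; rewrite /metric3; ring.
- by move=> p u; exact: metric3_pos.
- move=> c u v; rewrite (_ : (fun x => _) = fun x => metric3 x u v).
    exact/tame_smooth/metric3_tame.
  apply/funext => x; rewrite !tangent_change_torus.
  exact: (lattice_periodic_rep x (metric3_periodic u v)).
Defined.

Lemma T3_metric_proj x u v : T3_metric (torus_proj x) u v = metric3 x u v.
Proof. exact: (lattice_periodic_rep x (metric3_periodic u v)). Qed.
End Vec3.

(** * Smooth closed forms of comass at most 1 do not calibrate M *)

Section NotCalibrated.
Context {R : realType}.
Implicit Types (u : 'rV[R]_3).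

Lemma vec3_line (a b c h : R) :
  (h *: delta_mx 0 k0 + vec3 a b c = vec3 (h + a) b c) *
  (h *: delta_mx 0 k1 + vec3 a b c = vec3 a (h + b) c) *
  (h *: delta_mx 0 k2 + vec3 a b c = vec3 a b (h + c)).
Proof.
by split; [split|]; apply: rV3_eq; rewrite !mxE /= ?mulr1 ?mulr0 ?add0r.
Qed.

Lemma is_derive_restrict (W : 'rV[R]_3 -> R) (f : R -> R) (e p : 'rV[R]_3) (t : R) :
  (forall h, W (h *: e + p) = f (h + t)) -> derivable W p e ->
  is_derive t 1 f ('D_e W p).
Proof.
move=> Wf dW.
have E : (fun h : R => h^-1 *: ((W \o shift p) (h *: e) - W p)) =
         (fun h : R => h^-1 *: ((f \o shift t) (h *: 1) - f t)).
  apply/funext => h /=; rewrite Wf [_%:A]mulr1; congr (_ *: (_ - _)).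
  by have := Wf 0; rewrite scale0r !add0r.
apply: DeriveDef; first by move: dW; rewrite /derivable E.
by rewrite /derive E.
Qed.

Lemma vec3_continuous {T : topologicalType} (f g h : T -> R) :
  continuous f -> continuous g -> continuous h ->
  continuous (fun t => vec3 (f t) (g t) (h t)).
Proof.
move=> cf cg ch t; apply: mx_continuous => i; apply: ord3P.
- rewrite (_ : (fun y => _) = f); first exact: cf.
  by apply/funext => y; rewrite (ord1 i) vec3E.
- rewrite (_ : (fun y => _) = g); first exact: cg.
  by apply/funext => y; rewrite (ord1 i) vec3E.
- rewrite (_ : (fun y => _) = h); first exact: ch.
  by apply/funext => y; rewrite (ord1 i) vec3E.
Qed.

Lemma vec3_comp_continuous {T : topologicalType} (W : 'rV[R]_3 -> R) (f g h : T -> R) :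
  continuous W -> continuous f -> continuous g -> continuous h ->
  continuous (fun t => W (vec3 (f t) (g t) (h t))).
Proof.
move=> cW cf cg ch t.
apply: (@continuous_comp _ _ _ (fun t => vec3 (f t) (g t) (h t)) W); last exact: cW.
exact: vec3_continuous.
Qed.

Lemma chi_at0 : (chi 0 = 1 :> R) * (dchi 0 = 0 :> R).
Proof.
split; first by rewrite /chi mulr0 cos0 divff.
by rewrite /dchi mulr0 sin0 mulr0 oppr0.
Qed.

Lemma chi_at_half : (chi (1 / 2) = 0 :> R) * (dchi (1 / 2) = 0 :> R).
Proof.
have e : 2 * pi * (1 / 2) = pi :> R by field.
split; first by rewrite /chi e cospi subrr mul0r.
by rewrite /dchi e sinpi mulr0 oppr0.
Qed.

Variable w : diff_form (@T3 R) 1.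
Hypothesis sw : smooth_form w.
Hypothesis cw : forall p v, ext_deriv w p v = 0.
Hypothesis w1 : (comass T3_metric w <= 1)%E.

Lemma coef_le u (x : 'rV[R]_3) : (\sum_j u 0 j * coef w j x) ^+ 2 <= metric3 x u u.
Proof.
have := (comass_le1P T3_metric (fun p => (sw.1 p).1)).1 w1 (torus_proj x) (fun=> u).
by rewrite T3_metric_proj one_formE//; exact: (sw.1 _).1.
Qed.

Lemma coef_sym i j (x : 'rV[R]_3) : 'D_(delta_mx 0 i) (coef w j) x = 'D_(delta_mx 0 j) (coef w i) x.
Proof.
have [->//|ij] := eqVneq i j.
pose v (a : 'I_2) : 'rV[R]_3 := delta_mx 0 (if a == ord0 then i else j).
have := @ext_deriv_torus R 3 w x v (fun p => (sw.1 p).1).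
rewrite cw => E.
have {}E : 0 = \sum_k v (lift ord0 ord0) 0 k * 'D_(v ord0) (coef w k) x -
      \sum_k v ord0 0 k * 'D_(v (lift ord0 ord0)) (coef w k) x.
  by apply: E => y a k; have [_] := coef_smooth k sw [::] (x := y) I; exact.
have pick (a : 'I_3) (F : 'I_3 -> R) : \sum_k (delta_mx 0 a : 'rV[R]_3) 0 k * F k = F a.
  rewrite (bigD1 a)//= mxE !eqxx mul1r big1 ?addr0// => k ka.
  by rewrite mxE (negbTE ka) andbF mul0r.
move: E; rewrite (_ : v ord0 = delta_mx 0 i)// (_ : v (lift ord0 ord0) = delta_mx 0 j)//.
by rewrite !pick => /esym/eqP; rewrite subr_eq0 => /eqP.
Qed.

Lemma coef_derive i j (f : R -> R) p t :
  (forall h, coef w j (h *: delta_mx 0 i + p) = f (h + t)) ->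
  is_derive t 1 f ('D_(delta_mx 0 i) (coef w j) p).
Proof.
move=> h; apply: is_derive_restrict h _.
by have [_] := coef_smooth j sw [::] (x := p) I; exact.
Qed.

Lemma coef_not_calibrated : ~ (forall t, coef w k1 (vec3 0 t (1 / 2)) = 1).
Proof.
move=> cal.
pose W j (x y z : R) := coef w j (vec3 x y z).
pose H i j (x y z : R) := 'D_(delta_mx 0 i) (coef w j) (vec3 x y z).
have cW j : continuous (coef w j) by move=> x; have [] := coef_smooth j sw [::] (x := x) I.
have cH i j : continuous (fun x : 'rV[R]_3 => 'D_(delta_mx 0 i) (coef w j) x).
  by move=> x; have [] := coef_smooth j sw [:: i] (x := x) I.
have per (j : 'I_3) (x y z : R) : W j (x + 1) y z = W j x y z /\ W j x (y + 1) z = W j x y z.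
  by split; apply: coef_periodic; apply: ord3P;
    rewrite !vec3E ?subrr ?rpred0// addrAC subrr add0r rpred1.
have d0 (j : 'I_3) (x y z : R) : is_derive x 1 (fun x => W j x y z) (H k0 j x y z).
  by apply: coef_derive => h; rewrite vec3_line.
have d1 (j : 'I_3) (x y z : R) : is_derive y 1 (fun y => W j x y z) (H k1 j x y z).
  by apply: coef_derive => h; rewrite vec3_line.
have d2 (j : 'I_3) (x y z : R) : is_derive z 1 (fun z => W j x y z) (H k2 j x y z).
  by apply: coef_derive => h; rewrite vec3_line.
have Hs (i j : 'I_3) (x y z : R) : H i j x y z = H j i x y z by exact: coef_sym.
have cid : continuous (@id R) by move=> t; exact: cvg_id.
have cc (T : topologicalType) (c : R) : continuous (fun _ : T => c) by move=> t; exact: cvg_cst.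
have cf : continuous (@fst R R) by move=> t; exact: cvg_fst.
have cs : continuous (@snd R R) by move=> t; exact: cvg_snd.
have c0 y z := vec3_comp_continuous (cW k0) cid (cc _ y) (cc _ z).
have c1 x z := vec3_comp_continuous (cW k1) (cc _ x) cid (cc _ z).
have c2 x y := vec3_comp_continuous (cW k2) (cc _ x) (cc _ y) cid.
have e1 (x y z : R) : is_derive y 1 (fun y => W k0 x y z) (H k0 k1 x y z).
  by rewrite Hs; exact: d1.
have e2 (x y z : R) : is_derive z 1 (fun z => W k0 x y z) (H k0 k2 x y z).
  by rewrite Hs; exact: d2.
have e3 (x y z : R) : is_derive z 1 (fun z => W k1 x y z) (H k1 k2 x y z).
  by rewrite Hs; exact: d2.
have c3 z := vec3_comp_continuous (cH k0 k1) cf cs (cc _ z).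
have c4 y := vec3_comp_continuous (cH k0 k2) cf (cc _ y) cs.
have c5 x := vec3_comp_continuous (cH k1 k2) (cc _ x) cf cs.
have PQ0 (x y : R) : W k0 x y 0 ^+ 2 + W k1 x y 0 ^+ 2 <= 1 + wave y ^+ 2.
  set p := W k0 x y 0; set q := W k1 x y 0.
  (* On this slice the metric on (x, y) is a multiple of the Euclidean one, so the covector (p, q)
     itself, read as a vector, is the optimal test; the inequality obtained is then divided by
     [N]. *)
  have := coef_le (vec3 p q 0) (vec3 x y 0).
  rewrite sum_ord3 /metric3 !vec3E !chi_at0 -/(W k0 x y 0) -/(W k1 x y 0) -/p -/q.
  set s := wave y ^+ 2 => le1; have s0 : 0 <= s by exact: sqr_ge0.
  pose N := p ^+ 2 + q ^+ 2.
  have {}le1 : N ^+ 2 <= (1 + s) * N by rewrite /N; move: le1; lra.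
  have N0 : 0 <= N by rewrite addr_ge0 ?sqr_ge0.
  rewrite -/N; have [->|Npos] := eqVneq N 0; first by rewrite addr_ge0.
  by rewrite -(ler_pM2r (_ : 0 < N)) ?lt0r ?Npos// -expr2.
have PQ1 (x y a b : R) : (a * W k0 x y (1 / 2) + b * W k1 x y (1 / 2)) ^+ 2 <=
    (a + b) ^+ 2 + a ^+ 2.
  have := coef_le (vec3 a b 0) (vec3 x y (1 / 2)).
  rewrite sum_ord3 /metric3 !vec3E !chi_at_half.
  by rewrite -/(W k0 x y (1 / 2)) -/(W k1 x y (1 / 2)) => le1; move: le1; lra.
apply: (no_smooth_closed_form c0 c1 c2 (d0 k1) e1 (d0 k2) e2 (d1 k2) e3 c3 c4 c5
  (per k0) (per k1) (per k2) PQ0 PQ1 cal).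
by have [] := d1 k1 0 0 0.
Qed.
End NotCalibrated.

(** * Almost calibrating smooth forms *)

Section Approximation.
Context {R : realType}.

(* Polynomials in t^2 increasing to |t| on [-1, 1]. *)
Fixpoint abs_approx (n : nat) (t : R) : R :=
  if n is n'.+1 then abs_approx n' t + (t ^+ 2 - abs_approx n' t ^+ 2) / 2 else 0.

Lemma abs_approxN n t : abs_approx n (- t) = abs_approx n t.
Proof. by elim: n => //= n ->; rewrite sqrrN. Qed.

(** With a = |t| and p the current value, the new error is (a - p)(1 - (a + p)/2), at most d(1 -
    d/2) for d = a - p, because a + p >= d. As d(1 - d/2) increases on [0, 1], the rate 2/(n+2)
    propagates, by (n+1)(n+3) <= (n+2)^2. *)
Lemma abs_approx_bounds n t : `|t| <= 1 ->
  [/\ 0 <= abs_approx n t, abs_approx n t <= `|t| & `|t| - abs_approx n t <= 2 / n.+2%:R].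
Proof.
move=> t1; elim: n => [|n [p0 pt d]] /=; first by rewrite lexx normr_ge0 subr0 divff.
have t0 := normr_ge0 t.
rewrite -(real_normK (num_real t)); move: t0 t1 p0 pt d.
move: (`|t|) (abs_approx n t) => a p a0 a1 p0 pa d.
split; [nra|nra|].
have n2 : 0 < n.+2%:R :> R by rewrite ltr0n.
have n3 : 0 < n.+3%:R :> R by rewrite ltr0n.
pose e := 2 / n.+2%:R : R.
have e1 : e <= 1 by rewrite /e ler_pdivrMr// mul1r (ler_nat R 2).
have -> : a - (p + (a ^+ 2 - p ^+ 2) / 2) = (a - p) * (1 - (a + p) / 2) by field.
apply: (@le_trans _ _ (e * (1 - e / 2))).
  by have := d; rewrite -/e => de; nra.
rewrite /e ler_pdivlMr// (_ : _ * _ * _ = 2 * ((n.+2%:R - 1) * n.+3%:R) / (n.+2%:R ^+ 2)); last first.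
  by field; rewrite gt_eqF.
rewrite ler_pdivrMr ?exprn_gt0// ler_pM2l// -[n.+3%:R]natr1; nra.
Qed.

Definition wave_approx n y := pi / 2 * abs_approx n (sin (pi * y)).

Lemma wave_approx_periodic n : periodic1 (wave_approx n).
Proof. by move=> y; rewrite /wave_approx mulrDr mulr1 sinDpi abs_approxN. Qed.

Lemma smooth1_wave_approx n : smooth1 (wave_approx n).
Proof.
rewrite /wave_approx; apply: Smooth1Mul; first exact: Smooth1Cst.
elim: n => [|n IH] /=; first exact: Smooth1Cst.
apply: Smooth1Add => //; apply: Smooth1Mul; last exact: Smooth1Cst.
apply: Smooth1Add; first exact: smooth1_sqr (Smooth1Sin _).
rewrite (_ : (fun y => _) = fun y => -1 * abs_approx n (sin (pi * y)) ^+ 2).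
  by apply: Smooth1Mul; [exact: Smooth1Cst|exact: smooth1_sqr].
by apply/funext => y; rewrite mulN1r.
Qed.

Lemma wave_approx_bounds n y :
  [/\ 0 <= wave_approx n y, wave_approx n y <= `|wave y|
    & `|wave y| - wave_approx n y <= 4 / n.+2%:R].
Proof.
have [h1 h2 h3] := abs_approx_bounds n (sin_max (pi * y)).
have /andP[p0 p2] := @pihalf_02 R.
rewrite /wave_approx /wave normrM (gtr0_norm p0) -mulrBr; split.
- by rewrite mulr_ge0// ltW.
- by rewrite ler_pM2l.
rewrite (_ : 4 / _ = 2 * (2 / n.+2%:R)); last by rewrite mulrA -natrM.
by apply: ler_pM => //; [exact: ltW|rewrite subr_ge0|exact: ltW].
Qed.

(** [m] is the mean of [wave_approx n], so [F y - m * y] is periodic. On [0, 1) both terms lie in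
    [0, m], whence the bound on [k]; integrating the pointwise error over [0, 1], where [wave] has
    integral 1, bounds [1 - m]. *)
Lemma wave_approx_prim n : exists k m, [/\ smooth1 k /\ periodic1 k,
   forall y : R, is_derive y 1 k (wave_approx n y - m),
   forall y, k y ^+ 2 <= 1 & 0 <= m <= 1 /\ 1 - m <= 4 / n.+2%:R].
Proof.
have cw : continuous (wave_approx n).
  move=> y; have [f' _ /(_ y) df] := smooth1_derive (smooth1_wave_approx n).
  exact: is_derive_continuous df.
have [F dF F0] := antiderivative0 cw.
pose m := F 1; pose k y := F y - m * y.
have dk (y : R) : is_derive y 1 k (wave_approx n y - m).
  have := is_deriveB (dF y) (is_deriveM (is_derive_cst m y 1) (is_derive_id y 1)).
  by rewrite scaler0 addr0 [_%:A]mulr1.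
have k1 : periodic1 k.
  move=> y; apply/eqP; rewrite -subr_eq0; apply/eqP.
  have dd (u : R) : is_derive u 1 (fun u => k (u + 1) - k u) 0.
    rewrite -(subrr (wave_approx n u - m)); apply: is_deriveB (dk u).
    by apply: is_derive_comp_shift; rewrite -(wave_approx_periodic n u); exact: dk.
  rewrite (is_derive_eq0 y 0 dd) /k /m add0r F0; ring.
have Fmono a b : a <= b -> F a <= F b.
  move=> ab; apply: (is_derive_ge0_le ab (fun y _ => dF y)) => y _.
  by have [] := wave_approx_bounds n y.
have wave_abs y : y \in `[0, 1]%R -> `|wave y| = wave y.
  by rewrite in_itv/= => y01; rewrite ger0_norm// wave_ge0.
have m0 : 0 <= m by rewrite -F0; exact: Fmono.
have wp1 : wave_prim 1 = 1 :> R by rewrite -[1]add0r wave_primD1 wave_prim0 subr0 add0r.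
have m1 : m <= 1.
  have d (y : R) : is_derive y 1 (fun y => wave_prim y - F y) (wave y - wave_approx n y).
    by apply: is_deriveB; exact: is_derive_wave_prim.
  have := @is_derive_ge0_le _ _ _ 0 1 ler01 (fun y _ => d y).
  rewrite F0 wave_prim0 subr0 wp1 subr_ge0; apply => y /wave_abs <-.
  by rewrite subr_ge0; have [] := wave_approx_bounds n y.
exists k, m; split => //.
- split=> //; apply: Smooth1Prim dk _; apply: Smooth1Add; first exact: smooth1_wave_approx.
  exact: Smooth1Cst.
- move=> y; pose z := y - (Num.floor y)%:~R.
  have -> : k y = k z.
    by rewrite /z -(periodic1_int z k1 (intr_int _ (Num.floor y))) subrK.
  have /andP[z0 z1] : 0 <= z < 1.
    by have := floor_itv y; rewrite rmorphD/= => /andP[h1 h2]; rewrite /z; lra.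
  have f0 : 0 <= F z by rewrite -F0; exact: Fmono.
  have f1 : F z <= m by apply: Fmono; exact: ltW.
  have mz : 0 <= m * z by rewrite mulr_ge0.
  have mz1 : m * z <= m by rewrite ler_piMr// ltW.
  by rewrite /k; nra.
- split; first by rewrite m0.
  have d (y : R) : is_derive y 1 (fun y => 4 / n.+2%:R * y - (wave_prim y - F y))
     (4 / n.+2%:R - (wave y - wave_approx n y)).
    have := is_deriveB (is_deriveM (is_derive_cst (4 / n.+2%:R : R) y 1) (is_derive_id y 1))
      (is_deriveB (is_derive_wave_prim y) (dF y)).
    by rewrite scaler0 addr0 [_%:A]mulr1.
  have := @is_derive_ge0_le _ _ _ 0 1 ler01 (fun y _ => d y).
  rewrite F0 wave_prim0 !subr0 mulr0 wp1 mulr1 subr_ge0; apply => y /wave_abs <-.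
  by rewrite subr_ge0; have [] := wave_approx_bounds n y.
Qed.

End Approximation.

Section ApproxForm.
Context {R : realType}.
Variables (sg k : R -> R) (m : R).
Hypothesis sg_smooth : smooth1 sg.
Hypothesis sg_periodic : periodic1 sg.
Hypothesis sg_wave : forall y, sg y ^+ 2 <= wave y ^+ 2.
Hypothesis k_smooth : smooth1 k.
Hypothesis k_periodic : periodic1 k.
Hypothesis dk : forall y : R, is_derive y 1 k (sg y - m).
Hypothesis k_le1 : forall y, k y ^+ 2 <= 1.
Hypothesis m01 : 0 <= m <= 1.

(* dx + m dy + d(chi(z) k(y)) *)
Definition approx_coef (j : 'I_3) (x : 'rV[R]_3) : R :=
  if j == k0 then 1
  else if j == k1 then m + chi (x 0 k2) * (sg (x 0 k1) - m)
  else dchi (x 0 k2) * k (x 0 k1).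

Lemma approx_coef_tame j : tame (approx_coef j).
Proof.
have tc : tame (fun x : 'rV[R]_3 => chi (x 0 k2)) := TameCoord k2 smooth1_chi.
move: j; apply: ord3P; rewrite /approx_coef /=.
- exact: TameCst.
- apply: TameAdd; first exact: TameCst.
  apply: TameMul => //; apply: TameAdd; last exact: TameCst.
  exact (TameCoord k1 sg_smooth).
- by apply: TameMul; [exact (TameCoord k2 smooth1_dchi)|exact (TameCoord k1 k_smooth)].
Qed.

Lemma approx_coef_periodic j : lattice_periodic (approx_coef j).
Proof.
move=> x y xy; rewrite /approx_coef.
rewrite (periodic1_lattice k2 periodic1_chi xy) (periodic1_lattice k2 periodic1_dchi xy).
by rewrite (periodic1_lattice k1 sg_periodic xy) (periodic1_lattice k1 k_periodic xy).
Qed.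

Lemma approx_coef_sym i j x :
  'D_(delta_mx 0 i) (approx_coef j) x = 'D_(delta_mx 0 j) (approx_coef i) x.
Proof.
have deriv (e : 'rV[R]_3) :
  [/\ 'D_e (approx_coef k0) x = 0,
      e 0 k1 = 0 -> 'D_e (approx_coef k1) x = e 0 k2 * (dchi (x 0 k2) * (sg (x 0 k1) - m))
    & e 0 k2 = 0 -> 'D_e (approx_coef k2) x = e 0 k1 * (dchi (x 0 k2) * (sg (x 0 k1) - m))].
  have dc := @is_derive_coord _ _ chi dchi k2 x e (is_derive_chi (x 0 k2)).
  have [dd _ ddE] := smooth1_derive (@smooth1_dchi R).
  have ddc := @is_derive_coord _ _ dchi dd k2 x e (ddE (x 0 k2)).
  have [s' _ sE] := smooth1_derive sg_smooth.
  have ds := @is_derive_coord _ _ sg s' k1 x e (sE (x 0 k1)).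
  have dk' := @is_derive_coord _ _ k (fun y => sg y - m) k1 x e (dk (x 0 k1)).
  split; first exact: derive_cst.
  - move=> e1.
    have [_ d1] := is_deriveD (is_derive_cst m x e)
      (is_deriveM dc (is_deriveB ds (is_derive_cst m x e))).
    rewrite [LHS]d1 e1 mul0r subr0 scaler0 !add0r /GRing.scale/=.
    change ((sg (x 0 k1) - m) * (e 0 k2 * dchi (x 0 k2)) =
      e 0 k2 * (dchi (x 0 k2) * (sg (x 0 k1) - m))).
    by rewrite mulrC mulrA.
  - move=> e2; have [_ d2] := is_deriveM ddc dk'.
    by rewrite [LHS]d2 e2 mul0r scaler0 addr0 /GRing.scale/=; ring.
move: i j; apply: ord3P; apply: ord3P => //.
- by have [_ h _] := deriv (delta_mx 0 k0); have [h' _ _] := deriv (delta_mx 0 k1);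
    rewrite h' h ?mxE//= mul0r.
- by have [_ _ h] := deriv (delta_mx 0 k0); have [h' _ _] := deriv (delta_mx 0 k2);
    rewrite h' h ?mxE//= mul0r.
- by have [_ h _] := deriv (delta_mx 0 k0); have [h' _ _] := deriv (delta_mx 0 k1);
    rewrite h' h ?mxE//= mul0r.
- have [_ _ h] := deriv (delta_mx 0 k1); have [_ h' _] := deriv (delta_mx 0 k2).
  by rewrite h ?h' ?mxE.
- by have [_ _ h] := deriv (delta_mx 0 k0); have [h' _ _] := deriv (delta_mx 0 k2);
    rewrite h' h ?mxE//= mul0r.
- have [_ _ h] := deriv (delta_mx 0 k1); have [_ h' _] := deriv (delta_mx 0 k2).
  by rewrite h ?h' ?mxE.
Qed.

(** The horizontal part [A] interpolates between dx + m dy, of norm at most 1 for the sheared metric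
    as m lies in [0, 1], and dx + sg dy, of norm at most 1 for the conformal one. Convexity of the
    square handles the interpolation, and Cauchy-Schwarz with the factor 1 + d^2 absorbs the dz
    component. *)
Lemma approx_coef_le (u x : 'rV[R]_3) : (\sum_j u 0 j * approx_coef j x) ^+ 2 <= metric3 x u u.
Proof.
rewrite sum_ord3 /approx_coef/= mulr1 /metric3.
have := chi_ge0 (x 0 k2); have := chi_le1 (x 0 k2).
have := sg_wave (x 0 k1); have := k_le1 (x 0 k1); have /andP := m01.
move: (chi _) (dchi _) (sg _) (wave _) (k _) (u 0 k0) (u 0 k1) (u 0 k2).
move=> c d s w q a b e [m0 m1] q1 sw c1 c0.
pose A1 := a + m * b; pose A2 := a + s * b.
pose A := (1 - c) * A1 + c * A2.
have hA1 : A1 ^+ 2 <= (a + b) * (a + b) + a * a.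
  rewrite -subr_ge0 (_ : _ - _ = (a + (1 - m) * b) ^+ 2 + 2 * (m * (1 - m)) * b ^+ 2).
    have mm : 0 <= m * (1 - m) by rewrite mulr_ge0 ?subr_ge0.
    by rewrite addr_ge0 ?sqr_ge0// mulr_ge0 ?sqr_ge0// mulr_ge0.
  by rewrite /A1; ring.
have hA2 : A2 ^+ 2 <= (1 + w ^+ 2) * (a * a + b * b).
  apply: (@le_trans _ _ ((1 + s ^+ 2) * (a * a + b * b))).
    rewrite -subr_ge0 (_ : _ - _ = (s * a - b) ^+ 2) ?sqr_ge0// /A2; ring.
  by rewrite ler_wpM2r ?lerD2l// addr_ge0// -expr2 sqr_ge0.
have hA : A ^+ 2 <= (1 - c) * A1 ^+ 2 + c * A2 ^+ 2.
  rewrite -subr_ge0 (_ : _ - _ = c * (1 - c) * (A1 - A2) ^+ 2).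
    have cc : 0 <= c * (1 - c) by rewrite mulr_ge0 ?subr_ge0.
    by rewrite mulr_ge0 ?sqr_ge0.
  by rewrite /A; ring.
have -> : a + b * (m + c * (s - m)) + e * (d * q) = A + d * (q * e).
  by rewrite /A /A1 /A2; ring.
apply: (@le_trans _ _ ((1 + d ^+ 2) * (A ^+ 2 + (q * e) ^+ 2))).
  rewrite -subr_ge0 (_ : _ - _ = (d * A - q * e) ^+ 2) ?sqr_ge0//; ring.
apply: ler_wpM2l; first by rewrite addr_ge0 ?sqr_ge0.
apply: lerD; last by rewrite exprMn -expr2 ler_piMl// sqr_ge0.
apply: (le_trans hA); rewrite -mulrA; apply: lerD; apply: ler_wpM2l => //.
by rewrite subr_ge0.
Qed.

Definition approx_form := form_of approx_coef : diff_form (@T3 R) 1.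

Lemma approx_form_smooth : smooth_form approx_form.
Proof. exact: (form_of_smooth approx_coef_tame approx_coef_periodic). Qed.

Lemma approx_form_closed p v : ext_deriv approx_form p v = 0.
Proof.
exact: (form_of_closed approx_coef_tame approx_coef_periodic approx_coef_sym p v).
Qed.

Lemma approx_form_comass : (comass T3_metric approx_form <= 1)%E.
Proof.
apply/comass_le1P; first by move=> p; exact: (approx_form_smooth.1 p).1.
move=> p v; rewrite -[p](@torus_repK R 3) T3_metric_proj.
by rewrite /approx_form (form_of_proj approx_coef_periodic); exact: approx_coef_le.
Qed.
End ApproxForm.

(** * The circle M *)

Section Embedding.
Context {R : realType}.
Local Notation T1 := (torus_manifold R 1).
Implicit Types (t v : 'rV[R]_1).

Definition emb_lift t : 'rV[R]_3 := t *m delta_mx 0 k1 + vec3 0 0 (1 / 2).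

Lemma emb_liftE t : emb_lift t = vec3 0 (t 0 0) (1 / 2).
Proof.
by apply: rV3_eq; rewrite /emb_lift !mxE big_ord1 !mxE/= ?mulr0 ?mulr1 ?add0r ?addr0.
Qed.

Definition emb (p : torus R 1) : torus R 3 := torus_proj (emb_lift (torus_rep p)).

Lemma emb_proj t : emb (torus_proj t) = torus_proj (emb_lift t).
Proof.
apply: torus_proj_eq => i; rewrite !emb_liftE; move: i; apply: ord3P;
  rewrite !vec3E ?subrr ?rpred0//.
exact: (lift_at_lattice 0 t 0).
Qed.

(** A continuous left inverse of [emb], which yields both injectivity and the induced topology. *)
Definition unemb (q : torus R 3) : torus R 1 :=
  torus_proj (torus_rep q *m (delta_mx 0 k1)^T).

Lemma unemb_proj (x : 'rV[R]_3) : unemb (torus_proj x) = torus_proj (x *m (delta_mx 0 k1)^T).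
Proof.
apply: torus_proj_eq => i; rewrite !mxE !sum_ord3 (ord1 i) !mxE/= !mulr0 !mulr1 !add0r !addr0.
by rewrite addrAC subrr add0r rpredN intr_int.
Qed.

Lemma embK : cancel emb unemb.
Proof.
move=> p; rewrite /emb unemb_proj -[RHS]torus_repK; congr torus_proj.
apply/rowP => i; rewrite emb_liftE (ord1 i) mxE sum_ord3 !vec3E !mxE/=.
by rewrite !mulr0 mulr1 add0r addr0.
Qed.

Lemma affine0_continuous {n m : nat} (A : 'M[R]_(n, m)) :
  continuous (fun x : 'rV[R]_n => x *m A).
Proof.
rewrite (_ : (fun x => _) = fun x : 'rV[R]_n => x *m A + 0).
  exact: affine_continuous.
by apply/funext => x; rewrite addr0.
Qed.

Lemma emb_continuous : continuous emb.
Proof.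
apply: torus_continuous.
rewrite (_ : emb \o _ = @torus_proj R 3 \o emb_lift).
  move=> t; apply: continuous_comp; first exact: affine_continuous.
  exact: torus_proj_continuous.
by apply/funext => t /=; rewrite emb_proj.
Qed.

Lemma unemb_continuous : continuous unemb.
Proof.
apply: torus_continuous.
rewrite (_ : unemb \o _ = @torus_proj R 1 \o (fun x : 'rV[R]_3 => x *m (delta_mx 0 k1)^T)).
  move=> t; apply: continuous_comp; first exact: affine0_continuous.
  exact: torus_proj_continuous.
by apply/funext => t /=; rewrite unemb_proj.
Qed.

Lemma emb_chart_near c t : box c (lift_at c (emb_lift t)) ->
  \forall y \near t, emb_lift y + (lift_at c (emb_lift t) - emb_lift t) =
    torus_chart_map c (emb (torus_proj y)).
Proof.
move=> hc; have ca := @affine_continuous R 1 3 (delta_mx 0 k1) (vec3 0 0 (1 / 2)) t.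
have H : \forall y \near t, emb_lift y + (lift_at c (emb_lift t) - emb_lift t) =
  (torus_chart_map c \o @torus_proj R 3) (emb_lift y) := ca _ (torus_transition_near hc).
by near=> y; rewrite emb_proj; near: y; exact: H.
Unshelve. all: by end_near. Qed.

Lemma emb_smooth : @smooth_map R 1 3 T1 T3 emb.
Proof.
split; first exact: emb_continuous.
move=> c c'; apply: smooth_on_near => t /= [_].
rewrite /torus_chart_dom/= {1}/torus_chart_map emb_proj lift_at_proj => hc.
exists (fun y => emb_lift y + (lift_at c' (emb_lift t) - emb_lift t)); split.
  rewrite (_ : (fun y => _) = fun y => y *m delta_mx 0 k1 +
    (vec3 0 0 (1 / 2) + (lift_at c' (emb_lift t) - emb_lift t))).
    exact: smooth_affine.
  by apply/funext => y; rewrite [RHS]addrA.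
exact: emb_chart_near.
Qed.

Lemma emb_differential (p : T1) v :
  @differential R 1 3 T1 T3 emb p v = v *m delta_mx 0 k1.
Proof.
rewrite /differential /=; set x := torus_chart_map _ p.
have px : torus_proj x = p by rewrite /x torus_proj_lift_at torus_repK.
set c := torus_base (emb p).
have hc : box c (lift_at c (emb_lift x)).
  have := torus_baseP (emb p); rewrite -[in X in _ -> X]lift_at_proj -emb_proj px.
  exact.
have := is_derive_affine (delta_mx 0 k1)
  (vec3 0 0 (1 / 2) + (lift_at c (emb_lift x) - emb_lift x)) x v.
have near_eq : \forall y \near x, y *m delta_mx 0 k1 +
    (vec3 0 0 (1 / 2) + (lift_at c (emb_lift x) - emb_lift x)) =
    (torus_chart_map c \o emb \o @torus_proj R 1) y.
  by near=> y; rewrite [LHS]addrA; near: y; exact: (emb_chart_near hc).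
by move=> /(near_eq_is_derive near_eq)[_].
Unshelve. all: by end_near. Qed.

Lemma emb_differential_unit (p : T1) (a : 'I_1) :
  @differential R 1 3 T1 T3 emb p (delta_mx 0 a) = delta_mx 0 k1.
Proof.
rewrite emb_differential (ord1 a).
by apply/rowP => i; rewrite mxE big_ord1 mxE eqxx mul1r.
Qed.

Lemma emb_embedding : @smooth_embedding R 1 3 T1 T3 emb.
Proof.
split.
- exact: emb_smooth.
- move=> p v; rewrite emb_differential => /(congr1 (fun w : 'rV[R]_3 => w 0 k1)).
  rewrite !mxE big_ord1 mxE/= mulr1 => v0; apply/rowP => i.
  by rewrite (ord1 i) mxE.
- exact: can_inj embK.
- move=> A oA; exists (unemb @^-1` A).
    by move/continuousP: unemb_continuous; apply.
  by apply/funext => p /=; rewrite /preimage/= embK.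
Qed.

Lemma T1_compact : compact [set: T1].
Proof.
have -> : [set: T1] = @torus_proj R 1 @` [set v : 'rV[R]_1 | forall i, `[0, 1]%classic (v ord0 i)].
  apply/seteqP; split=> // p _; exists (torus_rep p); last exact: torus_repK.
  move=> i; rewrite -(eqP (torus_repP p)) /= in_itv/=.
  have := lift_at_ge 0 (torus_rep p) i; rewrite mxE add0r => /andP[-> /ltW].
  by [].
apply: continuous_compact.
  by apply: continuous_subspaceT => x; exact: torus_proj_continuous.
by apply: (@rV_compact R 1 (fun=> `[0, 1]%classic)) => i; exact: segment_compact.
Qed.

Definition circle : oriented_compact_submanifold (@T3 R) 1.
Proof.
refine (@OrientedCompactSubmanifold R 3 T3 1 T1 _ T1_compact torus_oriented emb emb_embedding).
by exists (torus_proj 0).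
Defined.

End Embedding.

(** * Integration over M and minimality *)

Section CircleIntegral.
Context {R : realType}.
Local Notation T1 := (torus_manifold R 1).
Local Notation mu := (@lebesgue_measure R).
Implicit Types (c : 'rV[R]_1) (psi w : diff_form (@T3 R) 1).

(** This is the point at which [rV_integral] evaluates its integrand in dimension 1. *)
Definition line_pt (t : R) : 'rV[R]_1 := row_mx t%:M (0 : 'rV[R]_0).

Lemma line_ptE t : line_pt t 0 0 = t.
Proof.
have h := row_mxEl (t%:M : 'M[R]_1) (0 : 'rV[R]_0) 0 0.
rewrite [RHS]mxE eqxx mulr1n in h; rewrite -[RHS]h /line_pt.
by congr (row_mx _ _ _ _); exact: val_inj.
Qed.

Lemma line_pt_continuous : continuous line_pt.
Proof.
move=> t; apply: mx_continuous => i j; rewrite (_ : (fun y => _) = id).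
  exact: cvg_id.
by apply/funext => y; rewrite (ord1 i) (ord1 j) line_ptE.
Qed.

Lemma box_line_pt c t : box c (line_pt t) <-> t \in `]c 0 0, (c 0 0 + 1)[%R.
Proof.
rewrite in_itv/=; split=> [/(_ 0)|h i]; first by rewrite line_ptE.
by rewrite (ord1 i) line_ptE.
Qed.

(** Continuity on the open interval gives measurability but does not control the ends; the bound [B]
    and the finite length give integrability. *)
Lemma integrable_on_chart c (H : 'rV[R]_1 -> R) (B : R) :
  (forall x, box c x -> {for x, continuous H}) -> (forall x, `|H x| <= B) ->
  mu.-integrable setT
    (EFin \o (fun t => if line_pt t \in box c then H (line_pt t) else 0)).
Proof.
move=> cH bH; pose D : set R := `]c 0 0, (c 0 0 + 1)[%classic.
rewrite (_ : EFin \o _ = (EFin \o (fun t => H (line_pt t))) \_ D); last first.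
  apply/funext => t; rewrite /= patchE; case: ifPn => tc.
    by rewrite mem_set// /D /=; apply/box_line_pt; rewrite inE in tc.
  rewrite memNset// /D /= => /box_line_pt h; move/negP: tc; apply.
  by rewrite inE.
suff intD : mu.-integrable D (EFin \o (fun t => H (line_pt t))).
  have K := @integrable_mkcond _ _ R mu D (EFin \o (fun t => H (line_pt t))) (measurable_itv _).
  exact: (K.1 intD).
apply: measurable_bounded_integrable; [exact: measurable_itv| | |].
- have : (mu [set` (`]c 0 0, (c 0 0 + 1)[%R)] < +oo)%E.
    by rewrite lebesgue_measure_itv/=; case: ifPn => _; rewrite ?ltry.
  exact.
- apply: measurable_realfun.open_continuous_measurable_fun; first exact: interval_open.
  move=> t tD; apply: (@continuous_comp _ _ _ line_pt H); first exact: line_pt_continuous.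
  by apply: cH; apply/box_line_pt; rewrite inE in tD.
- exists B; split; first exact: num_real.
  move=> b Bb t _; exact: (le_trans (bH _) (ltW Bb)).
Qed.

Lemma pullback_circle (q : T1 -> R) psi c (x : 'rV[R]_1) :
  local_form (fun p v => q p * pullback (inclusion circle) psi p v : R) c x
    (fun a => delta_mx 0 a) = q (torus_proj x) * coef psi k1 (emb_lift x).
Proof.
rewrite (@local_form_torus R 1) /pullback /= emb_proj; congr (_ * psi _ _).
by apply/funext => a; rewrite emb_differential_unit.
Qed.

Lemma chart_integral_circle (q : T1 -> R) psi c :
  chart_integral (X := T1) c (fun p v => q p * pullback (inclusion circle) psi p v) =
  \int[mu]_t (if line_pt t \in box c then
    q (torus_proj (line_pt t)) * coef psi k1 (emb_lift (line_pt t)) else 0).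
Proof.
rewrite /chart_integral /=; apply: eq_Rintegral => t _.
by rewrite /line_pt; case: ifPn => // _; rewrite pullback_circle.
Qed.

Lemma metric_circle (x : 'rV[R]_1) :
  metric3 (emb_lift x) (delta_mx 0 k1) (delta_mx 0 k1) = 1.
Proof.
by rewrite /metric3 emb_liftE !vec3E !chi_at_half !mxE/=; ring.
Qed.

Lemma coef_circle_bound psi (x : 'rV[R]_1) : smooth_form psi ->
  (comass T3_metric psi <= 1)%E -> `|coef psi k1 (emb_lift x)| <= 1.
Proof.
move=> sp cp; have := (comass_le1P T3_metric (fun p => (sp.1 p).1)).1 cp
  (torus_proj (emb_lift x)) (fun=> delta_mx 0 k1).
rewrite T3_metric_proj metric_circle => h.
by rewrite ler_norml -/(coef psi k1 _) in h *; apply/andP; split; nra.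
Qed.

(** Along M the coefficient of [psi] is at most 1 and that of [w] is [m]. The two integrals use the
    same partition of unity with nonnegative weights, so they are compared chart by chart. *)
Lemma integration_current_le psi w (m : R) : smooth_form psi ->
  (comass T3_metric psi <= 1)%E -> 0 <= m <= 1 ->
  (forall x, coef w k1 (emb_lift x) = m) ->
  m * integration_current circle psi <= integration_current circle w.
Proof.
move=> sp cp /andP[m0 m1] wm; rewrite /integration_current /form_integral.
(* In the default case of [xget] the list is empty and both integrals are 0. *)
case: xgetP => [s -> [ps sum1]|_]; last by rewrite !big_nil mulr0.
rewrite mulr_sumr 2!big_seq; apply: ler_sum => q qs.
have [sq q0 _] := ps q qs.
have q1 (p : T1) : q.2 p <= 1.
  rewrite -(sum1 p) (big_rem q qs)/= lerDl big_seq.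
  by apply: sumr_ge0 => q' /mem_rem q's; have [_ + _] := ps q' q's; apply.
have cq x : box q.1 x -> {for x, continuous (fun x => q.2 (torus_proj x))}.
  by move=> xc; have [] := sq q.1 [::] x xc.
have cpsi : continuous (fun x => coef psi k1 (emb_lift x)).
  move=> x; apply: (@continuous_comp _ _ _ emb_lift (coef psi k1)).
    exact: affine_continuous.
  by have [] := coef_smooth k1 sp [::] (x := emb_lift x) I.
rewrite !chart_integral_circle.
pose H1 x := q.2 (torus_proj x) * coef psi k1 (emb_lift x).
pose H2 x := q.2 (torus_proj x) * coef w k1 (emb_lift x).
have int1 : mu.-integrable setT
    (EFin \o (fun t => if line_pt t \in box q.1 then H1 (line_pt t) else 0)).
  apply: (@integrable_on_chart _ _ 1) => [x xc|x].
    exact: (continuousM (cq x xc) (cpsi x)).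
  rewrite /H1 normrM -[leRHS]mulr1 ler_pM// ?coef_circle_bound//.
  by rewrite ger0_norm.
have int2 : mu.-integrable setT
    (EFin \o (fun t => if line_pt t \in box q.1 then H2 (line_pt t) else 0)).
  apply: (@integrable_on_chart _ _ 1) => [x xc|x].
    rewrite (_ : H2 = fun y => q.2 (torus_proj y) * m).
      exact: (continuousM (cq x xc) (@cst_continuous _ _ m x)).
    by apply/funext => y; rewrite /H2 wm.
  rewrite /H2 wm normrM -[leRHS]mulr1 ler_pM//; first by rewrite ger0_norm.
  by rewrite ger0_norm.
rewrite -RintegralZl//; apply: le_Rintegral => //.
  pose f1 (t : R) : R := if line_pt t \in box q.1 then H1 (line_pt t) else 0.
  rewrite (_ : EFin \o _ = (fun t => m%:E * (EFin \o f1) t)%E); last exact/funext.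
  exact: integrableZl.
move=> t _; case: ifPn => _; last by rewrite mulr0.
rewrite /H1 wm mulrCA; apply: ler_wpM2l => //.
rewrite -[leRHS]mulr1; apply: ler_wpM2l => //.
exact: le_trans (ler_norm _) (coef_circle_bound _ sp cp).
Qed.

(** For each [psi] tested on M, an approximating form [w] satisfies m * I0 <= M(w) = T'(w) <= mass
    T', the equality because [w] is closed and [T'] is homologous to M. Then m tends to 1. *)
Lemma mass_circle_le (T' : diff_form (@T3 R) 1 -> R) : current T' ->
  homologous T' (integration_current circle) ->
  (mass T3_metric (integration_current circle) <= mass T3_metric T')%E.
Proof.
move=> cT [S [cS hS]]; apply: ge_ereal_sup => _ [psi [sp cp] <-].
set I0 := integration_current circle psi.
have bound n : exists2 m : R, [/\ 0 <= m, m <= 1 & 1 - m <= 4 / n.+2%:R] &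
    ((m * I0)%:E <= mass T3_metric T')%E.
  have [k [m [[sk pk] dk kle1 [/andP[m0 m1] m2]]]] := @wave_approx_prim R n.
  exists m => //.
  have ssg := @smooth1_wave_approx R n; have psg := @wave_approx_periodic R n.
  have sgw y : wave_approx n y ^+ 2 <= wave y ^+ 2 :> R.
    have [h0 h1 _] := wave_approx_bounds n y.
    by rewrite -(real_normK (num_real (wave y))) ler_sqr ?nnegrE.
  have m01 : 0 <= m <= 1 by rewrite m0.
  pose w := approx_form (wave_approx n) k m.
  have sw : smooth_form w by exact: approx_form_smooth.
  have cw : forall p v, ext_deriv w p v = 0 by move=> p v; exact: (approx_form_closed ssg psg sk pk dk).
  have cmw : (comass T3_metric w <= 1)%E by exact: approx_form_comass.
  have wm x : coef w k1 (emb_lift x) = m.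
    rewrite /w /approx_form form_of_coef; last exact: approx_coef_periodic.
    by rewrite /approx_coef/= emb_liftE vec3E !chi_at_half mul0r addr0.
  (* Currents are linear on smooth forms, so the zero form is shown to be smooth; applying [S] to 1
     * z + z = z then gives 0. *)
  have S0 : S (ext_deriv w) = 0.
    pose z : diff_form (@T3 R) 2 := fun _ _ => 0.
    have z0 : smooth_form z.
      split=> [p|i v]; first by split=> [? ? ? ? ?|//]; rewrite /z mulr0 addr0.
      exact: tame_smooth (TameCst _).
    have -> : ext_deriv w = z by apply/funext => p; apply/funext => v; exact: cw.
    have e : (fun p v => 1 * z p v + z p v) = z.
      by apply/funext => p; apply/funext => v; rewrite /z mulr0 addr0.
    have := cS.1 1 z z z0 z0; rewrite e.
    by rewrite mul1r => /eqP; rewrite -subr_eq subrr eq_sym => /eqP.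
  have TW : T' w = integration_current circle w.
    by have := hS w sw; rewrite /boundary S0 => /eqP; rewrite subr_eq0 => /eqP.
  apply: (@le_trans _ _ (T' w)%:E).
    by rewrite TW lee_fin; exact: integration_current_le.
  by apply: ereal_sup_ubound; exists w.
move: bound; case: (mass T3_metric T') => [M| |] bound; last 2 first.
- by rewrite leey.
- by have [m _] := bound 0%N; rewrite leeNy_eq.
rewrite lee_fin leNgt; apply/negP => MI.
(* The 8 is the 4 in the bound on 1 - m times 2: it makes (1 - m)(|I0| + 1) less than half of I0 -
   M, whereas m * I0 <= M gives I0 - M <= (1 - m)|I0|. *)
have d0 : 0 < (I0 - M) / (8 * (`|I0| + 1)).
  by rewrite divr_gt0 ?subr_gt0// mulr_gt0// ltr_wpDl.
have [n] := ltr_add_invr d0; rewrite add0r => hn.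
have [m [m0 m1 m2]] := bound n; rewrite lee_fin => mI.
have n2 : n.+2%:R^-1 <= n.+1%:R^-1 :> R by rewrite lef_pV2 ?posrE ?ltr0n// ler_nat.
have e : 1 - m < (I0 - M) / (2 * (`|I0| + 1)).
  apply: (le_lt_trans m2); apply: (@le_lt_trans _ _ (4 * n.+1%:R^-1)).
    by rewrite ler_wpM2l.
  rewrite [ltRHS](_ : _ = 4 * ((I0 - M) / (8 * (`|I0| + 1)))); first by rewrite ltr_pM2l.
  by field; rewrite gt_eqF// ltr_wpDl.
have i0 : 0 < `|I0| + 1 by rewrite ltr_wpDl.
rewrite ltr_pdivlMr ?mulr_gt0// in e.
have := ler_norm I0; have := normr_ge0 I0; nra.
Qed.
Lemma pullback_circle_unit w (x : 'rV[R]_1) :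
  pullback (inclusion circle) w (torus_proj x) (fun=> delta_mx 0 0) =
  coef w k1 (emb_lift x).
Proof.
rewrite /pullback /= emb_proj; congr (w _ _).
by apply/funext => a; rewrite emb_differential_unit.
Qed.

Lemma volume_form_circle (x : 'rV[R]_1) :
  volume_form (M := circle) T3_metric (torus_proj x) (fun=> delta_mx 0 0) = 1.
Proof.
rewrite /volume_form gram_det1 det_mx11 mxE mxE eqxx mulr1.
have -> : differential (inclusion circle) (torus_proj x : T1) (delta_mx 0 (ord0 : 'I_1)) =
  delta_mx 0 k1 by exact: emb_differential_unit.
have -> : inclusion circle (torus_proj x) = torus_proj (emb_lift x) by exact: emb_proj.
by rewrite T3_metric_proj metric_circle sqrtr1.
Qed.
End CircleIntegral.

Theorem mainTheorem6 (R : realType) :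
  exists (n m : nat) (X : smooth_manifold R n) (g : riemannian_metric X)
    (M : oriented_compact_submanifold X m),
    homologically_mass_minimizing g (integration_current M) /\
    ~ (exists w : diff_form X m, smooth_calibration g w /\ calibrates M g w).
Proof.
exists 3, 1, T3, T3_metric, circle; split; first exact: mass_circle_le.
move=> [w [[sw cw comass1] cal]].
have cw1 : (comass T3_metric w <= 1)%E by rewrite comass1.
apply: (coef_not_calibrated sw cw cw1) => t.
have := cal (torus_proj (const_mx t)) (fun=> delta_mx 0 0).
by rewrite pullback_circle_unit volume_form_circle emb_liftE mxE.
Qed.
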